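(* Let $G$ be a compact group and $\alpha$ an automorphism of $G$ such that the pair $(G,\alpha)$ is topologically transitive and has finite depth. Then any two subnormal series for $(G,\alpha)$ (consisting of closed, $\alpha$-stable, topologically transitive subgroups of $G$) have equivalent refinements.
   Context: All groups are Hausdorff topological groups and automorphisms are automorphisms of topological groups. A subgroup $H$ is $\alpha$-stable if $\alpha(H)=H$. A pair $(K,\beta)$ with $K$ compact and $\beta\in\mathrm{Aut}(K)$ is topologically transitive if there is $x\in K$ whose orbit $\{\beta^n(x): n\in\mathbb{Z}\}$ is dense in $K$; a closed $\alpha$-stable subgroup $H$ is called topologically transitive if $(H,\alpha|_H)$ is. The pair $(G,\alpha)$ has finite depth if there is an open subgroup $V\le G$ with $\bigcap_{k\in\mathbb{Z}}\alpha^k(V)=\{1\}$. A subnormal series for $(G,\alpha)$ is a sequence $\{1\}=G_0\le G_1\le\cdots\le G_r=G$ of closed, $\alpha$-stable, topologically transitive subgroups such that, for each $j\in\{1,\dots,r\}$, $G_{j-1}$ is normal in $G_j$ and the automorphism $\alpha_j$ induced by $\alpha$ on $G_j/G_{j-1}$ is topologically transitive; the pairs $(G_j/G_{j-1},\alpha_j)$ are its subquotients. A refinement of a subnormal series is a subnormal series in which all the subgroups of the original series appear, possibly together with others. Two pairs $(G_1,\alpha_1)$, $(G_2,\alpha_2)$ (compact groups with automorphisms) are co-commensurable if there is a compact group $H$ with automorphism $\beta$ and surjective continuous homomorphisms $\varphi_i:H\to G_i$ with finite kernels satisfying $\varphi_i\circ\beta=\alpha_i\circ\varphi_i$ for $i=1,2$.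 Two subnormal series $\{1\}=G_0\le\cdots\le G_r=G$ and $\{1\}=H_0\le\cdots\le H_s=G$ are equivalent if $r=s$ and there is a permutation $\pi$ of $\{1,\dots,r\}$ such that each subquotient $(G_j/G_{j-1},\alpha_j)$ is co-commensurable with $(H_{\pi(j)}/H_{\pi(j)-1},\alpha'_{\pi(j)})$, where $\alpha'_i$ denotes the induced automorphism on $H_i/H_{i-1}$. *)

(* Defs.v *)
From HB Require Import structures.
From mathcomp Require Import all_boot all_algebra.
From mathcomp Require Import all_classical.
From mathcomp Require Import topology_theory.topology.
From mathcomp Require Import topology_theory.quotient_topology.
From mathcomp Require Import perm.

Set Implicit Arguments.
Unset Strict Implicit.
Unset Printing Implicit Defensive.

Local Open Scope classical_set_scope.

Record topGroup := TopGroup {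
  tg_sort :> topologicalType;
  tg_mul : tg_sort -> tg_sort -> tg_sort;
  tg_one : tg_sort;
  tg_inv : tg_sort -> tg_sort;
  tg_mulA : associative tg_mul;
  tg_mul1g : left_id tg_one tg_mul;
  tg_mulVg : left_inverse tg_one tg_inv tg_mul;
  tg_mul_cont : continuous (fun p : tg_sort * tg_sort => tg_mul p.1 p.2);
  tg_inv_cont : continuous tg_inv;
  tg_hausdorff : hausdorff_space tg_sort
}.

Arguments tg_mul {t}.
Arguments tg_one {t}.
Arguments tg_inv {t}.

Record aut (G : topGroup) := Aut {
  af :> G -> G;
  ainv : G -> G;
  af_K : cancel af ainv;
  ainv_K : cancel ainv af;
  af_morph : forall x y, af (tg_mul x y) = tg_mul (af x) (af y);
  af_cont : continuous af;
  ainv_cont : continuous ainv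
}.

Definition zpowf (T : Type) (f g : T -> T) (n : int) : T -> T :=
  match n with
  | Posz k => iter k f
  | Negz k => iter k.+1 g
  end.

Definition zorbit (T : Type) (f g : T -> T) (x : T) : set T :=
  [set zpowf f g n x | n in [set: int]].

Definition top_transitive (T : topologicalType) (S : set T) (f g : T -> T) :=
  exists2 x, S x & S `<=` closure (zorbit f g x).

Definition is_subgroup (G : topGroup) (H : set G) :=
  [/\ H tg_one,
      forall x y, H x -> H y -> H (tg_mul x y) &
      forall x, H x -> H (tg_inv x)].

Definition normal_in (G : topGroup) (A B : set G) :=
  forall b a, B b -> A a -> A (tg_mul (tg_mul b a) (tg_inv b)).

Definition stable (G : topGroup) (a : aut G) (H : set G) := a @` H = H.

Definition good_subgroup (G : topGroup) (a : aut G) (H : set G) :=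
  [/\ is_subgroup H, closed H, stable a H & top_transitive H a (ainv a)].

Definition finite_depth (G : topGroup) (a : aut G) :=
  exists V : set G, [/\ is_subgroup V, open V &
    \bigcap_(k in [set: int]) (zpowf a (ainv a) k @` V) = [set tg_one]].

Definition lcoset (G : topGroup) (x : G) (A : set G) : set G :=
  [set tg_mul x y | y in A].

Definition coset_rel (G : topGroup) (A : set G) : rel G :=
  fun x y => `[< lcoset x A = lcoset y A >].

Lemma coset_rel_refl (G : topGroup) (A : set G) : reflexive (coset_rel A).
Proof. by move=> x; apply/asboolP. Qed.

Lemma coset_rel_sym (G : topGroup) (A : set G) : symmetric (coset_rel A).
Proof.
by move=> x y; apply/asboolP/asboolP => H.
Qed.

Lemma coset_rel_trans (G : topGroup) (A : set G) : transitive (coset_rel A).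
Proof.
move=> y x z /asboolP H1 /asboolP H2; apply/asboolP.
by rewrite H1.
Qed.

Canonical coset_equiv (G : topGroup) (A : set G) :=
  EquivRel (coset_rel A) (@coset_rel_refl G A) (@coset_rel_sym G A)
           (@coset_rel_trans G A).

Local Open Scope quotient_scope.

Definition coset_space (G : topGroup) (A : set G) : topologicalType :=
  quotient_topology {eq_quot (coset_rel A)}.

Record sq_data := SqData {
  sq_T : topologicalType;
  sq_S : set sq_T;
  sq_mul : sq_T -> sq_T -> sq_T;
  sq_one : sq_T;
  sq_f : sq_T -> sq_T;
  sq_finv : sq_T -> sq_T
}.
Arguments sq_S : clear implicits.
Arguments sq_mul : clear implicits.
Arguments sq_one : clear implicits.
Arguments sq_f : clear implicits.
Arguments sq_finv : clear implicits.

(* The subquotient B/A (A normal in B, A <= B), realised as the image of B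
   in the coset space G/A (for closed A <= B this subspace is the quotient
   topological group B/A, since G -> G/A is open), with the group law
   induced via representatives and the automorphism induced by a. *)
Definition subquotient (G : topGroup) (a : aut G) (A B : set G) : sq_data :=
  let Q := coset_space A in
  let pi : G -> Q := \pi_({eq_quot (coset_rel A)}) in
  @SqData Q (pi @` B)
    (fun X Y => pi (tg_mul (repr (X : {eq_quot (coset_rel A)}))
                            (repr (Y : {eq_quot (coset_rel A)}))))
    (pi tg_one)
    (fun X => pi (a (repr (X : {eq_quot (coset_rel A)}))))
    (fun X => pi (ainv a (repr (X : {eq_quot (coset_rel A)})))).

Definition sq_top_transitive (D : sq_data) :=
  top_transitive (sq_S D) (sq_f D) (sq_finv D).

Definition cocommensurable (D1 D2 : sq_data) :=
  exists (K : topGroup) (b : aut K), compact [set: K] /\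
  exists (p1 : K -> sq_T D1) (p2 : K -> sq_T D2),
  [/\ [/\ continuous p1, p1 @` setT = sq_S D1,
          forall x y, p1 (tg_mul x y) = sq_mul D1 (p1 x) (p1 y),
          finite_set [set k | p1 k = sq_one D1] &
          forall k, p1 (b k) = sq_f D1 (p1 k)] &
      [/\ continuous p2, p2 @` setT = sq_S D2,
          forall x y, p2 (tg_mul x y) = sq_mul D2 (p2 x) (p2 y),
          finite_set [set k | p2 k = sq_one D2] &
          forall k, p2 (b k) = sq_f D2 (p2 k)]].

(* Subnormal series: s 0, ..., s r (values of s beyond r are ignored)  *)
Definition subnormal_series (G : topGroup) (a : aut G) (r : nat)
    (s : nat -> set G) :=
  [/\ s 0%N = [set tg_one], s r = [set: G],
      (forall j, (j <= r)%N -> good_subgroup a (s j)) &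
      (forall j, (0 < j <= r)%N ->
         [/\ s j.-1 `<=` s j, normal_in (s j.-1) (s j) &
             sq_top_transitive (subquotient a (s j.-1) (s j))])].

Definition refinement (G : topGroup) (a : aut G) (r : nat) (s : nat -> set G)
    (r' : nat) (s' : nat -> set G) :=
  subnormal_series a r' s' /\
  forall i, (i <= r)%N -> exists2 j, (j <= r')%N & s' j = s i.

(* the j-th subquotient, j : 'I_r standing for index j+1 *)
Definition series_sq (G : topGroup) (a : aut G) (r : nat) (s : nat -> set G)
    (j : 'I_r) : sq_data :=
  subquotient a (s j) (s j.+1).

Definition equivalent_series (G : topGroup) (a : aut G) (r : nat)
    (s : nat -> set G) (r' : nat) (s' : nat -> set G) :=
  exists e : r = r', exists p : {perm 'I_r},
    forall j : 'I_r,
      cocommensurable (series_sq a s j) (series_sq a s' (cast_ord e (p j))).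

(* Main.v *)
From HB Require Import structures.
Require Import Defs.
From mathcomp Require Import all_boot all_algebra all_classical.
From mathcomp Require Import topology_theory.topology.

(* Schreier's refinement argument works once the subgroups it produces, which
   need not be topologically transitive, are replaced by their nubs.

   Finite depth gives an open normal subgroup [V] that separates points along
   orbits, so that [x |-> (a^k x V)_k] identifies [G] with a group shift over
   the finite alphabet [G / V]; every closed stable subgroup [A] is then of
   finite type (Kitchens), which says that after shrinking [V] one has
   [A & V = (A & V)_- (A & V)_+], where the two factors stay in [V] under all
   negative, respectively all nonnegative, powers of [a].  The nub of [A] is
   the closure of the group of its homoclinic points ([a^k x -> 1] as
   [k -> +oo] and as [k -> -oo]).  It is topologically transitive, because
   homoclinic points can be shifted out of each other's way; it is relatively
   open in [A], by splicing; and it is normal in every group that normalizes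
   [A], because the homoclinic points are.  A transitive group has no proper
   closed stable subgroup of finite index, hence is its own nub.

   So the series [s] is refined by [nub (s_i (s_{i+1} & t_j))], and [t]
   symmetrically.  In Zassenhaus' lemma both subquotients are images of
   [nub D / nub E], with [D = s_{i+1} & t_{j+1}] and
   [E = (s_i & t_{j+1}) (s_{i+1} & t_j)]: the maps are onto because their images
   have finite index in a transitive group, and their kernels are finite because
   [nub E] has finite index in [E]. *)

Set Implicit Arguments.
Unset Strict Implicit.
Unset Printing Implicit Defensive.

Local Open Scope classical_set_scope.

Declare Scope topgroup_scope.
Delimit Scope topgroup_scope with tg.
Local Notation "x * y" := (tg_mul x y) : topgroup_scope.
Local Notation "x ^-1" := (tg_inv x) : topgroup_scope.
Local Notation "1" := tg_one : topgroup_scope.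
Local Open Scope topgroup_scope.

(** A cluster point of a sequence of points [x n] in [K] and [C n] lies in every [C n], because a
    tail of the sequence does. The passages below from finitely many conditions to infinitely many
    rest on this. *)
Lemma decreasing_closed_meet (T : topologicalType) (K : set T)
    (C : nat -> set T) :
  compact K -> (forall n, closed (C n)) -> (forall n, C n.+1 `<=` C n) ->
  (forall n, exists2 x, K x & C n x) -> exists2 x, K x & forall n, C n x.
Proof.
move=> cK clC decC neC.
have {neC} [x xK xC] : exists2 x : nat -> T,
    forall n, K (x n) & forall n, C n (x n).
  have /choice[x xP] : forall n, exists x, K x /\ C n x.
    by move=> n; have [x] := neC n; exists x.
  by exists x => n; have [] := xP n.
have leC m n : (m <= n)%N -> C n `<=` C m.
  move=> /subnK <-; elim: (n - m)%N => [//|k IH] y.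
  by rewrite addSn => /decC /IH.
have [p [Kp clp]] : K `&` cluster (x @ \oo) !=set0.
  by apply: cK; exists 0%N => // n _; exact: xK.
exists p => // n; rewrite [C n](closure_id _).1 // => B nB.
apply: (clp (C n) B) => //.
by exists n => // m /= nm; apply: leC (xC m).
Qed.

(** * Topological groups *)

Section GroupLaws.
Context {G : topGroup}.
Implicit Types x y z : G.

Lemma tg_mulAr x y z : x * y * z = x * (y * z).
Proof. by rewrite tg_mulA. Qed.

Lemma tg_mulKg x y : x^-1 * (x * y) = y.
Proof. by rewrite tg_mulA tg_mulVg tg_mul1g. Qed.

Lemma tg_mulgI x y z : x * y = x * z -> y = z.
Proof. by move=> e; rewrite -(tg_mulKg x y) e tg_mulKg. Qed.

Lemma tg_mulg1 x : x * 1 = x.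
Proof. by apply: (@tg_mulgI x^-1); rewrite tg_mulKg tg_mulVg. Qed.

Lemma tg_mulgV x : x * x^-1 = 1.
Proof. by apply: (@tg_mulgI x^-1); rewrite tg_mulKg tg_mulg1. Qed.

Lemma tg_mulVKg x y : x * (x^-1 * y) = y.
Proof. by rewrite tg_mulA tg_mulgV tg_mul1g. Qed.

Lemma tg_invK x : x^-1^-1 = x.
Proof. by apply: (@tg_mulgI x^-1); rewrite tg_mulgV tg_mulVg. Qed.

Lemma tg_inv1 : 1^-1 = 1 :> G.
Proof. by apply: (@tg_mulgI 1); rewrite tg_mulgV tg_mul1g. Qed.

Lemma tg_invM x y : (x * y)^-1 = y^-1 * x^-1.
Proof.
by apply: (@tg_mulgI (x * y)); rewrite tg_mulgV tg_mulAr tg_mulVKg tg_mulgV.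
Qed.

End GroupLaws.

(* Normal form of words in the free group. *)
Ltac grp := rewrite ?(tg_invM, tg_invK, tg_inv1, tg_mulAr, tg_mulKg, tg_mulVKg,
  tg_mulgV, tg_mulVg, tg_mul1g, tg_mulg1).

(* [compact_cover] is only stated for pointed spaces. *)
Definition pointed_group (G : topGroup) : Type := G.
HB.instance Definition _ (G : topGroup) :=
  Topological.copy (pointed_group G) (tg_sort G).
HB.instance Definition _ (G : topGroup) :=
  isPointed.Build (pointed_group G) tg_one.

Section Basics.
Context {G : topGroup}.
Implicit Types (x y z : G) (A B H V W : set G).

Lemma sub1g H : is_subgroup H -> H 1. Proof. by case. Qed.
Lemma subM H x y : is_subgroup H -> H x -> H y -> H (x * y).
Proof. by case=> _ + _; exact. Qed.
Lemma subV H x : is_subgroup H -> H x -> H x^-1.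
Proof. by case=> _ _; exact. Qed.
Lemma subVM H x y : is_subgroup H -> H x -> H y -> H (x^-1 * y).
Proof. by move=> sH /(subV sH); exact: subM. Qed.
Lemma subMV H x y : is_subgroup H -> H x -> H y -> H (x * y^-1).
Proof. by move=> sH Hx /(subV sH); exact: subM. Qed.
Lemma subVE H x : is_subgroup H -> H x^-1 -> H x.
Proof. by move=> sH /(subV sH); rewrite tg_invK. Qed.
Lemma subMl H x y : is_subgroup H -> H x -> H (x * y) -> H y.
Proof. by move=> sH Hx /(subVM sH Hx); grp. Qed.
Lemma subMr H x y : is_subgroup H -> H y -> H (x * y) -> H x.
Proof. by move=> sH Hy Hxy; have := subMV sH Hxy Hy; grp. Qed.

Lemma subgroupI A B : is_subgroup A -> is_subgroup B -> is_subgroup (A `&` B).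
Proof.
move=> sA sB; split; first by split; exact: sub1g.
  by move=> x y [? ?] [? ?]; split; exact: subM.
by move=> x [? ?]; split; exact: subV.
Qed.

Lemma subgroup_normal_mul A B : is_subgroup A -> is_subgroup B ->
  (forall b a, B b -> A a -> A (b * a * b^-1)) ->
  is_subgroup [set x | exists2 y, A y & B (y^-1 * x)].
Proof.
move=> sA sB nAB; split=> /=.
- by exists 1; [exact: sub1g | grp; exact: sub1g].
- move=> x y [u Au Bu] [v Av Bv]; exists (u * (u^-1 * x * v * (u^-1 * x)^-1)).
    by apply: subM => //; exact: nAB.
  by have := subM sB Bu Bv; grp.
- move=> x [u Au Bu]; exists ((u^-1 * x)^-1 * u^-1 * (u^-1 * x)^-1^-1).
    by apply: nAB; exact: subV.
  by have := subV sB Bu; grp.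
Qed.

Lemma mulgl_cont x : continuous (tg_mul x).
Proof.
move=> y; apply: (@continuous_comp G (G * G)%type G (fun z => (x, z))
  (fun p => p.1 * p.2)); last exact: tg_mul_cont.
by apply: cvg_pair; [exact: cvg_cst | exact: cvg_id].
Qed.

Lemma mulgr_cont x : continuous (fun y => y * x).
Proof.
move=> y; apply: (@continuous_comp G (G * G)%type G (fun z => (z, x))
  (fun p => p.1 * p.2)); last exact: tg_mul_cont.
by apply: cvg_pair; [exact: cvg_id | exact: cvg_cst].
Qed.

Lemma open_preim (T U : topologicalType) (f : T -> U) (O : set U) :
  continuous f -> open O -> open [set x | O (f x)].
Proof. by move=> /continuousP; exact. Qed.

Lemma closed_preim (T U : topologicalType) (f : T -> U) (C : set U) :
  continuous f -> closed C -> closed [set x | C (f x)].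
Proof. by move=> /continuous_closedP; exact. Qed.

Lemma open_coset W x : open W -> open [set y | W (x^-1 * y)].
Proof. by move=> oW; apply: (open_preim (@mulgl_cont _)). Qed.

Definition onormal W := [/\ is_subgroup W, open W &
  forall x y, W x -> W (y * x * y^-1)].

Lemma onormal_conjV W x y : onormal W -> W x -> W (y^-1 * x * y).
Proof. by move=> [_ _ nW] /(nW _ y^-1); rewrite tg_invK. Qed.

Lemma onormal_sym W x y : onormal W -> W (x * y) -> W (y * x).
Proof. by move=> oW /(onormal_conjV x oW); grp. Qed.

Lemma onormalI A B : onormal A -> onormal B -> onormal (A `&` B).
Proof.
move=> [sA oA nA] [sB oB nB]; split; first exact: subgroupI.
  exact: openI.
by move=> x y [? ?]; split; [exact: nA|exact: nB].
Qed.

Lemma onormalT : onormal [set: G].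
Proof. by split=> //; exact: openT. Qed.

Lemma open_subgroup_closed W : is_subgroup W -> open W -> closed W.
Proof.
move=> sW oW; rewrite -openC.
have -> : ~` W = \bigcup_(t in ~` W) [set y | W (t^-1 * y)].
  apply/seteqP; split=> [x nWx | x [t nWt /= Wtx] Wx].
    by exists x => //=; grp; exact: sub1g.
  by apply: nWt; apply: subVE => //; exact: subMr Wx Wtx.
by apply: bigcup_open => t _; exact: open_coset.
Qed.

(** Compactness leaves finitely many of the open left cosets of [V]. Finite index is used in this
    form throughout, as a list of representatives. *)
Lemma coset_cover V : compact [set: G] -> is_subgroup V -> open V ->
  exists T : seq G, forall x, exists2 t, t \in T & V (t^-1 * x).
Proof.
move=> cG sV oV; move: (cG : @compact (pointed_group G) setT).
rewrite compact_cover => {}cG.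
have [|x _|T _ cT] := cG G setT (fun t => [set y | V (t^-1 * y)]).
- by move=> t _; exact: open_coset.
- by exists x => //=; grp; exact: sub1g.
by exists (finmap.enum_fset T) => x; have [//|t /= tT Vx] := cT x; exists t.
Qed.

(** The basis at the identity is left arbitrary: it will be the open normal subgroups or the windows
    of one expansive [V]. *)
Lemma closure_basis (W0 : set (set G)) A x :
  (forall U, open U -> U 1 -> exists2 W, W0 W & W `<=` U) ->
  (forall W, W0 W -> exists2 d, A d & W (x^-1 * d)) -> closure A x.
Proof.
move=> basis apx U; rewrite nbhsE /= => -[O [oO Ox] OU].
have [||W WW WO] := basis [set y | O (x * y)] _ _.
- exact: (open_preim (@mulgl_cont _)).
- by rewrite /= tg_mulg1.
by have [d Ad /WO /=] := apx W WW; grp => Od; exists d; split=> //; apply: OU.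
Qed.

Lemma closure_coset A W x : closure A x -> open W -> W 1 ->
  exists2 d, A d & W (x^-1 * d).
Proof.
move=> clA oW W1; have [|d [Ad Wd]] := clA [set d | W (x^-1 * d)].
  by apply: open_nbhs_nbhs; split; [exact: open_coset | rewrite /= tg_mulVg].
by exists d.
Qed.

End Basics.

(** * Contraction and homoclinic points *)

(** Time reversal. It is transparent, so that a lemma on [a] applied to [aut_inv a] becomes, by
    conversion, a lemma on the iterates of [ainv a]. *)
Definition aut_inv (G : topGroup) (a : aut G) : aut G.
Proof.
apply: (@Aut G (ainv a) a (ainv_K a) (af_K a)).
- by move=> x y; apply: (can_inj (af_K a)); rewrite af_morph !ainv_K.
- exact: ainv_cont.
- exact: af_cont.
Defined.

Section Iterates.
Context {G : topGroup} (a : aut G).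
Implicit Types (x y : G) (V : set G).

Lemma iter_autM k x y : iter k a (x * y) = iter k a x * iter k a y.
Proof. by elim: k => //= k ->; rewrite af_morph. Qed.

Lemma iter_aut1 k : iter k a 1 = 1.
Proof. by apply: (@tg_mulgI _ (iter k a 1)); rewrite -iter_autM; grp. Qed.

Lemma iter_autV k x : iter k a x^-1 = (iter k a x)^-1.
Proof.
apply: (@tg_mulgI _ (iter k a x)); rewrite -iter_autM; grp.
by rewrite iter_aut1.
Qed.

Lemma autV x : a x^-1 = (a x)^-1.
Proof. exact: (iter_autV 1). Qed.

Lemma iter_aut_cont k : continuous (iter k a).
Proof.
elim: k => [|k IH]; first by move=> x; exact: cvg_id.
move=> x; apply: (@continuous_comp _ _ _ (iter k a) a); first exact: IH.
exact: af_cont.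
Qed.

Lemma iter_autK k j x : (j <= k)%N ->
  iter j (ainv a) (iter k a x) = iter (k - j) a x.
Proof.
elim: j k => [|j IH] k; first by rewrite subn0.
by case: k => // k jk; rewrite iterSr iterS af_K IH.
Qed.

Lemma iter_autVK k j x : (j <= k)%N ->
  iter k (ainv a) (iter j a x) = iter (k - j) (ainv a) x.
Proof.
elim: j k => [|j IH] k; first by rewrite subn0.
by case: k => // k jk; rewrite iterSr iterS af_K IH.
Qed.

Lemma onormal_iter V k : onormal V -> onormal [set x | V (iter k a x)].
Proof.
move=> [sV oV nV]; split; first split => /=.
- by rewrite iter_aut1; exact: sub1g.
- by move=> x y; rewrite iter_autM; exact: subM.
- by move=> x; rewrite iter_autV; exact: subV.
- exact: (open_preim (@iter_aut_cont k)).
- by move=> x y /= Vx; rewrite !iter_autM iter_autV; exact: nV.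
Qed.

End Iterates.

Lemma ainvM (G : topGroup) (a : aut G) (x y : G) :
  ainv a (x * y) = ainv a x * ainv a y.
Proof. exact: (af_morph (aut_inv a)). Qed.

Lemma ainvV (G : topGroup) (a : aut G) (x : G) : ainv a x^-1 = (ainv a x)^-1.
Proof. exact: (autV (aut_inv a)). Qed.

Lemma iter_aut_invK (G : topGroup) (a : aut G) k j (x : G) : (j <= k)%N ->
  iter j a (iter k (ainv a) x) = iter (k - j) (ainv a) x.
Proof. exact: (iter_autK (aut_inv a)). Qed.

Lemma iter_aut_invVK (G : topGroup) (a : aut G) k j (x : G) : (j <= k)%N ->
  iter k a (iter j (ainv a) x) = iter (k - j) a x.
Proof. exact: (iter_autVK (aut_inv a)). Qed.

(** The translates of [V] under all powers of [a] have at most the identity in common; the two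
    hypotheses are the two halves of the orbit. *)
Definition expansive (G : topGroup) (a : aut G) (V : set G) :=
  forall x, (forall k, V (iter k a x)) -> (forall k, V (iter k (ainv a) x)) ->
  x = 1.

(** In the picture of [G] as a shift over [G / V], the cylinder around the identity on the times
    from [-m] to [m]. *)
Definition window (G : topGroup) (a : aut G) (V : set G) (m : nat) : set G :=
  [set x | forall k, (k <= m)%N -> V (iter k a x) /\ V (iter k (ainv a) x)].

Definition contracts (G : topGroup) (f : G -> G) (x : G) :=
  forall U : set G, open U -> U 1 ->
  exists n, forall k, (n <= k)%N -> U (iter k f x).

Definition homoclinic (G : topGroup) (a : aut G) (A : set G) : set G :=
  [set x | [/\ A x, contracts a x & contracts (ainv a) x]].

Definition nub (G : topGroup) (a : aut G) (A : set G) : set G :=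
  closure (homoclinic a A).

Record csub (G : topGroup) (a : aut G) (A : set G) : Prop := Csub {
  csub_sub : is_subgroup A;
  csub_closed : closed A;
  csub_f : forall x, A x -> A (a x);
  csub_g : forall x, A x -> A (ainv a x) }.

Section Windows.
Context {G : topGroup}.
Implicit Types (a : aut G) (x y : G) (A V U : set G).

Lemma expansive_inv a V : expansive a V -> expansive (aut_inv a) V.
Proof. by move=> eV x fx gx; exact: eV. Qed.

Lemma csub_inv a A : csub a A -> csub (aut_inv a) A.
Proof. by case. Qed.

Lemma csub_iter a A k x : csub a A -> A x -> A (iter k a x).
Proof. by move=> cA Ax; elim: k => //= k; exact: csub_f. Qed.

Lemma csub_iterV a A k x : csub a A -> A x -> A (iter k (ainv a) x).
Proof. by move/csub_inv; exact: csub_iter. Qed.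

Lemma window_le a V m n : (m <= n)%N -> window a V n `<=` window a V m.
Proof. by move=> mn x Wx k km; apply: Wx; exact: leq_trans mn. Qed.

Lemma windowS a V m : window a V m.+1 = window a V m `&`
  ([set x | V (iter m.+1 a x)] `&` [set x | V (iter m.+1 (ainv a) x)]).
Proof.
apply/seteqP; split=> x.
  by move=> Wx; split; [exact: window_le Wx | exact: Wx].
move=> [Wx [fx gx]] k; rewrite leq_eqVlt => /orP[/eqP->//|]; exact: Wx.
Qed.

Lemma onormal_window a V m : onormal V -> onormal (window a V m).
Proof.
move=> oV; elim: m => [|m IH].
  suff -> : window a V 0 = V by [].
  apply/seteqP; split=> x; first by case/(_ 0%N).
  by move=> Vx k; rewrite leqn0 => /eqP ->.
rewrite windowS; apply: onormalI => //; apply: onormalI.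
  exact: onormal_iter.
exact: (onormal_iter (aut_inv a)).
Qed.

Lemma window_iter a V n k x :
  window a V (k + n)%N x -> window a V n (iter k a x).
Proof.
move=> Wx j jn; split.
  by rewrite -iterD; apply: (Wx _ _).1; rewrite addnC leq_add2l.
have [jk|/ltnW kj] := leqP j k.
  rewrite iter_autK //; apply: (Wx _ _).1.
  by apply: leq_trans (leq_subr _ _) (leq_addr _ _).
rewrite iter_autVK //; apply: (Wx _ _).2.
by apply: leq_trans (leq_subr _ _) (leq_trans jn (leq_addl _ _)).
Qed.

Section Basis.
Hypothesis cG : compact [set: G].

(** If no window were contained in [U], the parts of the closed windows outside [U] would have a
    common point by compactness. Expansiveness makes that point the identity, which is in [U]. *)
Lemma window_basis a V U : onormal V -> expansive a V -> open U -> U 1 ->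
  exists m, window a V m `<=` U.
Proof.
move=> oV eV oU U1; apply: contrapT => nW.
have [|||x _ xC] := @decreasing_closed_meet _ setT
    (fun m => window a V m `&` ~` U) cG.
- move=> n; apply: closedI; last exact: open_closedC.
  by have [sW oW _] := onormal_window a n oV; exact: open_subgroup_closed.
- by move=> n x [Wx nUx]; split=> //; exact: window_le Wx.
- move=> n; apply: contrapT => h; apply: nW; exists n => x Wx.
  by apply: contrapT => nUx; apply: h; exists x.
suff x1 : x = 1 by have [_] := xC 0%N; rewrite x1.
by apply: eV => k; have [/(_ k (leqnn k))[]] := xC k.
Qed.

(** Eventual membership in the single subgroup [V] suffices: from time [n + m] on, all times within
    [m] of [k] are at least [n], so that [a^k x] is in the window of radius [m]. *)
Lemma contracts_expansive a V x : onormal V -> expansive a V ->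
  (exists n, forall k, (n <= k)%N -> V (iter k a x)) -> contracts a x.
Proof.
move=> oV eV [n Vx] U oU U1; have [m WU] := window_basis oV eV oU U1.
exists (n + m)%N => k nmk; apply: WU => j jm; split.
  rewrite -iterD; apply: Vx; apply: leq_trans (leq_addl _ _).
  exact: leq_trans (leq_addr _ _) nmk.
have jk : (j <= k)%N by apply: leq_trans jm (leq_trans (leq_addl _ _) nmk).
rewrite iter_autK //; apply: Vx; rewrite leq_subRL // (leq_trans _ nmk) //.
by rewrite addnC leq_add2l.
Qed.

End Basis.

Definition onormal_basis := forall U, open U -> U 1 ->
  exists2 W, onormal W & W `<=` U.

Lemma contracts1 a : contracts a 1.
Proof. by move=> U _ U1; exists 0%N => k _; rewrite iter_aut1. Qed.

Section OnormalBasis.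
Hypothesis bG : onormal_basis.

Lemma contractsP a x :
  (forall W, onormal W -> exists n, forall k, (n <= k)%N -> W (iter k a x)) ->
  contracts a x.
Proof.
move=> h U oU U1; have [W nW WU] := bG oU U1.
by have [n hn] := h W nW; exists n => k /hn /WU.
Qed.

Lemma contractsW a x W : onormal W -> contracts a x ->
  exists n, forall k, (n <= k)%N -> W (iter k a x).
Proof. by move=> [sW oW _]; apply => //; exact: sub1g. Qed.

Lemma contractsM a x y : contracts a x -> contracts a y -> contracts a (x * y).
Proof.
move=> cx cy; apply: contractsP => W oW.
have [m mx] := contractsW oW cx; have [n ny] := contractsW oW cy.
exists (maxn m n) => k; rewrite geq_max => /andP[/mx ? /ny ?].
by rewrite iter_autM; apply: subM => //; case: oW.
Qed.

Lemma contractsV a x : contracts a x -> contracts a x^-1.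
Proof.
move=> cx; apply: contractsP => W oW; have [m mx] := contractsW oW cx.
by exists m => k /mx; rewrite iter_autV; apply: subV; case: oW.
Qed.

(** The conjugators [a^k y] need not converge; normality of [W] absorbs them. *)
Lemma contracts_conj a x y : contracts a x -> contracts a (y * x * y^-1).
Proof.
move=> cx; apply: contractsP => W oW; have [m mx] := contractsW oW cx.
by exists m => k /mx; rewrite !iter_autM iter_autV; case: oW => _ _; exact.
Qed.

Lemma contracts_iter a x k : contracts a x -> contracts a (iter k a x).
Proof.
move=> cx U oU U1; have [n hn] := cx U oU U1; exists n => j nj.
by rewrite -iterD; apply: hn; apply: leq_trans (leq_addr _ _).
Qed.

Lemma contracts_iterV a x k : contracts a x -> contracts a (iter k (ainv a) x).
Proof.
move=> cx U oU U1; have [n hn] := cx U oU U1; exists (k + n)%N => j knj.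
rewrite iter_aut_invVK; last exact: leq_trans (leq_addr _ _) knj.
apply: hn; rewrite leq_subRL //; exact: leq_trans (leq_addr _ _) knj.
Qed.

Lemma homoclinic_sub a A : is_subgroup A -> is_subgroup (homoclinic a A).
Proof.
move=> sA; split.
- split; [exact: sub1g | exact: contracts1 |].
  exact: (@contracts1 (aut_inv a)).
- move=> x y [Ax fx gx] [Ay fy gy]; split; first exact: subM.
    exact: contractsM.
  exact: (@contractsM (aut_inv a)).
- move=> x [Ax fx gx]; split; first exact: subV.
    exact: contractsV.
  exact: (@contractsV (aut_inv a)).
Qed.

Lemma closureG A x :
  (forall W, onormal W -> exists2 d, A d & W (x^-1 * d)) -> closure A x.
Proof. exact: closure_basis. Qed.

Lemma nubW a A x W : nub a A x -> onormal W ->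
  exists2 d, homoclinic a A d & W (x^-1 * d).
Proof.
by move=> nx [sW oW _]; apply: closure_coset => //; exact: sub1g.
Qed.

Lemma nub_subset a A : closed A -> nub a A `<=` A.
Proof.
move=> cA; rewrite /nub => x; rewrite {2}[A](closure_id _).1 //.
by apply: closureS => y [].
Qed.

Lemma nub_mono a A B : A `<=` B -> nub a A `<=` nub a B.
Proof. by move=> AB; apply: closureS => x [/AB Bx fx gx]; split. Qed.

Lemma nub_csub a A : csub a A -> csub a (nub a A).
Proof.
move=> [sA cA fA gA]; have sH := homoclinic_sub a sA.
have sub d : homoclinic a A d -> nub a A d by exact: subset_closure.
split; [split| exact: closed_closure | |].
- by apply: sub; exact: sub1g.
- move=> x y nx ny; apply: closureG => W oW.
  have [d hd Wd] := nubW nx oW; have [e he We] := nubW ny oW.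
  exists (d * e); first exact: subM.
  (* Normality of [W] carries the error made in approximating [x] past [y]. *)
  have : W ((y^-1 * (x^-1 * d) * y^-1^-1) * (y^-1 * e)).
    by case: oW => sW _ nW; apply: subM => //; exact: nW.
  by grp.
- move=> x nx; apply: closureG => W oW; have [d hd Wd] := nubW nx oW.
  exists d^-1; first exact: subV.
  rewrite tg_invK; have : W (x * (x^-1 * d)^-1 * x^-1).
    by case: oW => sW _ nW; apply: nW; exact: subV.
  by grp.
- move=> x nx; apply: closureG => W oW.
  have [d [Ad fd gd] Wd] := nubW nx (onormal_iter a 1 oW).
  exists (a d); last first.
    by have := Wd : W (iter 1 a (x^-1 * d)); rewrite iter_autM iter_autV.
  split; first exact: fA.
    exact: (contracts_iter 1 fd).
  exact: (@contracts_iterV (aut_inv a) d 1 gd).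
- move=> x nx; apply: closureG => W oW.
  have [d [Ad fd gd] Wd] := nubW nx (onormal_iter (aut_inv a) 1 oW).
  exists (ainv a d).
    split; first exact: gA.
      exact: (contracts_iterV 1 fd).
    exact: (@contracts_iter (aut_inv a) d 1 gd).
  have : W (iter 1 (aut_inv a) (x^-1 * d)) by [].
  by rewrite iter_autM iter_autV.
Qed.

Lemma nub_normal a A B : normal_in A B -> normal_in (nub a A) B.
Proof.
move=> nAB b x Bb nx; apply: closureG => W oW.
have [d [Ad fd gd] Wd] := nubW nx oW; exists (b * d * b^-1).
  split; first exact: nAB.
    exact: contracts_conj.
  exact: (@contracts_conj (aut_inv a)).
by case: oW => _ _ /(_ _ b Wd); grp.
Qed.

End OnormalBasis.
End Windows.
Arguments onormal_basis : clear implicits.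

(** * Closed stable subgroups are of finite type *)

(** The times are [-1, ..., -n]. Time 0 is left free: modulo [V] this set records which values at
    time 0 can follow a trivial past of length [n]. *)
Definition past (G : topGroup) (a : aut G) (V : set G) (n : nat) : set G :=
  [set x | forall k, (k < n)%N -> V (iter k.+1 (ainv a) x)].

(** Each [t] satisfies [Q n t] for all [n] or fails from some [n] on; [N] bounds these finitely many
    thresholds. *)
Lemma decreasing_stabilizes (T : eqType) (Q : nat -> T -> Prop) (s : seq T) :
  (forall m n t, (m <= n)%N -> Q n t -> Q m t) ->
  exists N, forall t, t \in s -> Q N t -> forall n, Q n t.
Proof.
move=> decQ; elim: s => [|t s [N IH]]; first by exists 0%N.
have [Qt|/existsNP[n nQt]] := pselect (forall n, Q n t).
  by exists N => u; rewrite inE => /orP[/eqP->|/IH].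
exists (maxn n N) => u; rewrite inE => /orP[/eqP->|/IH h].
  by move=> /(decQ n _ _ (leq_maxl _ _)) /nQt.
by move=> /(decQ N _ _ (leq_maxr _ _)) /h.
Qed.

Lemma coset_cover_in (G : topGroup) (X V : set G) :
  compact [set: G] -> is_subgroup X -> is_subgroup V -> open V ->
  exists2 T : seq G, (forall t, t \in T -> X t) &
    forall x, X x -> exists2 t, t \in T & V (t^-1 * x).
Proof.
move=> cG sX sV oV; have [T cT] := coset_cover cG sV oV.
(* Each representative [t] is replaced by a point of [X] in its coset if there is one, and by the
   default 1 otherwise. *)
have /choice[r rP] : forall t, exists u, X u /\
    ((exists2 x, X x & V (t^-1 * x)) -> V (t^-1 * u)).
  move=> t; have [[x Xx Vx]|h] := pselect (exists2 x, X x & V (t^-1 * x)).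
    by exists x.
  by exists 1; split=> //; exact: sub1g.
exists (map r T) => [_ /mapP[t _ ->]|x Xx]; first by have [] := rP t.
have [t tT Vx] := cT x; exists (r t); first exact: map_f.
have [_ Vr] := rP t; have := subVM sV (Vr (ex_intro2 _ _ x Xx Vx)) Vx.
by grp.
Qed.

Section Splitting.
Context {G : topGroup} (a : aut G).
Hypothesis cG : compact [set: G].
Implicit Types (x y z w : G) (V A : set G).

Lemma pastS V n :
  past a V n.+1 = past a V n `&` [set x | V (iter n.+1 (ainv a) x)].
Proof.
apply/seteqP; split=> x.
  by move=> Px; split; [move=> k kn; apply: Px; exact: ltnW | exact: Px].
by move=> [Px Vx] k; rewrite ltnS leq_eqVlt => /orP[/eqP->//|]; exact: Px.
Qed.

Lemma onormal_past V n : onormal V -> onormal (past a V n).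
Proof.
move=> oV; elim: n => [|n IH].
  suff -> : past a V 0 = setT by exact: onormalT.
  by apply/seteqP; split.
by rewrite pastS; apply: onormalI => //; exact: (onormal_iter (aut_inv a)).
Qed.

(* The subgroups [past n V / V] of the finite group [G / V] decrease with [n],
   hence stabilize. *)
Lemma past_stabilizes V A : onormal V -> csub a A -> exists N, forall x,
  A x -> past a V N x -> exists w, [/\ A w, forall n, past a V n w &
    V (w^-1 * x)].
Proof.
move=> oV cA; have [sV openV _] := oV; have sA := csub_sub cA.
pose Q n x := exists w, [/\ A w, past a V n w & V (w^-1 * x)].
have [T cT] := coset_cover cG sV openV.
have [|N QN] := @decreasing_stabilizes G Q T _.
  move=> m n t mn [w [Aw Pw Vw]]; exists w; split=> // k km; apply: Pw.
  exact: leq_trans km mn.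
exists N => x Ax Px; have [t tT Vtx] := cT x.
have Qx n : Q n x.
  have [|w [Aw Pw Vw]] := QN t tT _ n.
    exists x; split=> //; have := subV sV Vtx; grp; exact.
  by exists w; split=> //; have := subM sV Vw Vtx; grp.
(* The coset of [x] contains, for each [n], a point with trivial past of length [n]; compactness
   yields one point for all [n]. *)
have [||n|w _ wP] := @decreasing_closed_meet _ setT (fun n => A `&`
    (past a V n `&` [set w | V (x^-1 * w)])) cG.
- move=> n; apply: closedI; first exact: csub_closed cA.
  have [sP oP _] := onormal_past n oV.
  apply: closedI; first exact: open_subgroup_closed.
  apply: (closed_preim (@mulgl_cont _ _)); exact: open_subgroup_closed.
- move=> n w [Aw [Pw Vw]]; split=> //; split=> //.
  by move: Pw; rewrite pastS => -[].
- have [w [Aw Pw Vw]] := Qx n; exists w => //; split=> //; split=> //=.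
  by have := subV sV Vw; grp.
exists w; split; first by have [] := wP 0%N.
  by move=> n; have [_ []] := wP n.
by have [_ [_ Vw]] := wP 0%N; have := subV sV Vw; grp.
Qed.

(** Finite type in the form used below: modulo [V], the factor [y] is trivial at all times [<= 0]
    and [z] at all times [>= 0]. *)
Definition splits V A := forall x, A x -> V x -> exists y z,
  [/\ A y, A z, x = y * z, forall k, V (iter k (ainv a) y) &
      forall k, V (iter k a z)].

(** The point [w] is built by successive corrections: at stage [n], [w^-1 * x] is in [V] at the
    times [0, ..., n - 1], while [w] keeps a trivial past. A limit point of the stages serves for
    all times. *)
Lemma past_split V A : onormal V -> csub a A -> exists N, forall x,
  A x -> past a V N.+1 x -> exists w, [/\ A w, forall n, past a V n w &
    forall k, V (iter k a (w^-1 * x))].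
Proof.
move=> oV cA; have [sV openV _] := oV; have sA := csub_sub cA.
have [N hN] := past_stabilizes oV cA; exists N => x Ax.
have sP n : is_subgroup (past a V n) by have [] := onormal_past n oV.
move=> /(_ _ (ltnW _)) Px.
have {}Px : past a V N x by move=> k kN; apply: Px.
have step n : exists w, [/\ A w, forall m, past a V m w &
    forall k, (k < n)%N -> V (iter k a (w^-1 * x))].
  elim: n => [|n [w [Aw Pw Vw]]]; first by exists 1; split=> //;
    [exact: sub1g | move=> m; exact: sub1g].
  (* Seen from time [n], the error [w^-1 * x] has a trivial past of length [N]: the times
     [0, ..., n - 1] by induction, the negative ones because [w] and [x] both do. So its value at
     time [n] is that of some [u] with trivial infinite past, and multiplying [w] by [a^-n u]
     corrects time [n] without disturbing earlier times. *)
  have [||u [Au Pu Vu]] := hN (iter n a (w^-1 * x)).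
  - by apply: csub_iter => //; exact: subVM.
  - move=> k kN; have [kn|nk] := ltnP k n.
      rewrite iter_autK //; apply: (Vw (n - k.+1)%N).
      by rewrite ltn_subrL (leq_ltn_trans _ kn).
    rewrite iter_autVK ?(leqW nk) // subSn //.
    have Pwx := subVM (sP N) (Pw N) Px.
    by apply: (Pwx (k - n)%N); rewrite (leq_ltn_trans (leq_subr _ _)).
  exists (w * iter n (ainv a) u); split.
  - by apply: subM => //; exact: csub_iterV.
  - move=> m; apply: (subM (sP m)) => // k _.
    rewrite -iterD addSn; exact: (Pu _ _ (ltnSn (k + n))).
  - move=> k; rewrite ltnS leq_eqVlt => /orP[/eqP ->|kn].
      rewrite tg_invM tg_mulAr iter_autM iter_autV iter_aut_invVK // subnn.
      exact: Vu.
    rewrite tg_invM tg_mulAr iter_autM iter_autV iter_aut_invK ?(ltnW kn) //.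
    apply: subVM => //; last exact: Vw.
    rewrite -(ltn_predK (_ : 0 < n - k)%N) ?subn_gt0 //.
    exact: (Pu _ _ (ltnSn (n - k).-1)).
have [||n|w _ wP] := @decreasing_closed_meet _ setT (fun n => A `&`
    ([set w | past a V n w] `&`
     [set w | forall k, (k < n)%N -> V (iter k a (w^-1 * x))])) cG.
- move=> n; apply: closedI; first exact: csub_closed cA.
  apply: closedI.
    by apply: open_subgroup_closed; have [] := onormal_past n oV.
  have -> : [set w | forall k, (k < n)%N -> V (iter k a (w^-1 * x))] =
      \bigcap_(k in [set k | (k < n)%N]) [set w | V (iter k a (x^-1 * w))].
    apply/seteqP; split=> w h k /h => Vk; apply: (subVE sV).
      by rewrite /= -iter_autV; grp.
    by rewrite /= -iter_autV; grp.
  apply: closed_bigI => k _.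
  apply: (@closed_preim _ _ (tg_mul x^-1) [set w | V (iter k a w)]).
    exact: mulgl_cont.
  by apply: open_subgroup_closed; have [] := onormal_iter a k oV.
- move=> n w [Aw [Pw Vw]]; split=> //; split=> k kn; [apply: Pw|apply: Vw];
    exact: leqW.
- have [w [Aw Pw Vw]] := step n; exists w => //.
  by split=> //; split; [exact: Pw | exact: Vw].
exists w; split; first by have [] := wP 0%N.
  by move=> n; have [_ []] := wP n.
by move=> k; have [_ [_]] := wP k.+1; apply.
Qed.

(** The new subgroup is [past a V N.+1]. The whole past of [w] is in [V], hence its backward
    iterates are in the new subgroup; [w^-1 * x] is in [V] at all times [>= 0] and at the [N + 1]
    preceding ones, hence so are its forward iterates. *)
Lemma exists_splitting V A : onormal V -> expansive a V -> csub a A ->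
  exists V', [/\ onormal V', expansive a V' & splits V' A].
Proof.
move=> oV eV cA; have sA := csub_sub cA; have [N hN] := past_split oV cA.
exists (past a V N.+1); split; first exact: onormal_past.
- move=> x fx gx.
  have fxV k : V (iter k a x).
    by have := fx k.+1 0%N isT; rewrite /= af_K.
  apply: eV => // -[|k]; first exact: (fxV 0%N).
  exact: (gx k 0%N isT).
- move=> x Ax Px; have [w [Aw Pw Vw]] := hN x Ax Px.
  exists w, (w^-1 * x); split=> //; first exact: subVM.
  + by grp.
  + by move=> k j _; rewrite -iterD addSn; exact: (Pw _ _ (ltnSn (j + k))).
  + move=> k j jN; have [jk|kj] := ltnP j k; first by rewrite iter_autK.
    rewrite iter_autVK ?(leqW kj) // subSn //.
    have [sP _ _] := onormal_past N.+1 oV.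
    apply: (subVM sP (Pw N.+1) Px).
    exact: leq_ltn_trans (leq_subr _ _) jN.
Qed.

End Splitting.

(** * The nub *)

(** For a subgroup [Y] of a group [X] this makes [Y] open in [X], hence of finite index when [X] is
    compact. *)
Definition rel_open (G : topGroup) (Y X : set G) :=
  exists2 V : set G, onormal V & forall x, X x -> V x -> Y x.

Section NubOpen.
Context {G : topGroup}.
Hypothesis cG : compact [set: G].
Implicit Types (a : aut G) (x y z w : G) (V A : set G).

Lemma expansive_basis a V : onormal V -> expansive a V -> onormal_basis G.
Proof.
move=> oV eV U oU U1; have [m WU] := window_basis cG oV eV oU U1.
by exists (window a V m) => //; exact: onormal_window.
Qed.

Lemma closure_window a V A x : onormal V -> expansive a V ->
  (forall m, exists2 d, A d & window a V m (x^-1 * d)) -> closure A x.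
Proof.
move=> oV eV h.
apply: (@closure_basis _ (range (window a V))) => [U oU U1|_ [m _ <-]] //.
have [m WU] := window_basis cG oV eV oU U1.
by exists (window a V m) => //; exists m.
Qed.

(* Pigeonhole on the cosets of the points [a^-n x]. *)
Lemma backward_invariant a A V (R : set G) : is_subgroup R -> csub a A ->
  is_subgroup V -> open V -> (forall x, A x -> V x -> R x) ->
  (forall x, R x -> R (a x)) -> forall x, A x -> R (a x) -> R x.
Proof.
move=> sR cA sV oV VR aR x Ax Rax; have sA := csub_sub cA.
have [T cT] := coset_cover cG sV oV.
have /choice[t tP] : forall n, exists t,
    t \in T /\ V (t^-1 * iter n (ainv a) x).
  by move=> n; have [t] := cT (iter n (ainv a) x); exists t.
have : ~~ uniq (mkseq t (size T).+1).
  apply/negP => ut; have := @uniq_leq_size _ _ T ut.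
  rewrite size_mkseq ltnn => h.
  by apply/notF/h => _ /mapP[n _ ->]; have [] := tP n.
move=> /(uniqPn 1)[m [n [mn]]]; rewrite size_mkseq => nT.
rewrite !nth_mkseq //; last exact: ltn_trans nT.
move=> tmn; have [_ Vm] := tP m; have [_ Vn] := tP n.
have : R ((iter m (ainv a) x)^-1 * iter n (ainv a) x).
  apply: VR; first by apply: subVM => //; exact: csub_iterV.
  by have := subVM sV Vm Vn; rewrite tmn; grp.
have aiR k y : R y -> R (iter k a y) by move=> Ry; elim: k => //= k /aR.
(* Applying [a^(m+1)] to [(a^-m x)^-1 * a^-n x] gives [(a x)^-1 * a^(m+1-n) x]. As [a x] is in [R],
   so is [a^(m+1-n) x], and forward invariance leads back to [x]. *)
move=> /(aiR m.+1); rewrite iter_autM iter_autV iter_aut_invVK // subSnn.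
rewrite iter_aut_invK // => /(subMl sR (subV sR Rax)).
by move=> /(aiR (n - m.+1)%N); rewrite iter_aut_invK // subnn.
Qed.

(** * Points asymptotic to the identity in the past, up to [V] *)

Section UnstableSubgroup.
Context (a : aut G) (A V : set G).
Hypotheses (oV : onormal V) (eV : expansive a V) (cA : csub a A).
Hypothesis sVA : splits a V A.

Let bG : onormal_basis G := expansive_basis oV eV.
Let sA : is_subgroup A := csub_sub cA.
Let sV : is_subgroup V.
Proof. by case: oV. Qed.

(** The elements of [A] in the product of the backward contracted points of [A] with [V]. The lemmas
    below make it a subgroup that contains [A & V] and is invariant in both time directions. *)
Definition unstable_nbhs : set G :=
  [set x | A x /\ exists c, [/\ A c, contracts (ainv a) c & V (c^-1 * x)]].

Lemma contracts_past y : (forall k, V (iter k (ainv a) y)) ->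
  contracts (ainv a) y.
Proof.
move=> Vy; apply: (@contracts_expansive _ cG (aut_inv a) V) => //.
  exact: expansive_inv.
by exists 0%N => k _; exact: Vy.
Qed.

(** The error [c^-1 * x] splits into a part with past in [V], which contracts backward and is
    absorbed into [c], and a part with future in [V]. *)
Lemma unstable_split x : unstable_nbhs x -> exists c z,
  [/\ A c, contracts (ainv a) c, A z, x = c * z & forall k, V (iter k a z)].
Proof.
move=> [Ax [c [Ac cc Vx]]].
have [y [z [Ay Az e Vy Vz]]] := sVA (subVM sA Ac Ax) Vx.
exists (c * y), z; split=> //; first exact: subM.
  by apply: (@contractsM _ bG (aut_inv a)) => //; exact: contracts_past.
by rewrite tg_mulAr -e; grp.
Qed.

Lemma unstable_sub : is_subgroup unstable_nbhs.
Proof.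
split.
- split; first exact: sub1g.
  exists 1; split; first exact: sub1g.
    exact: (@contracts1 _ (aut_inv a)).
  by grp; exact: sub1g.
- move=> x y [Ax [c [Ac cc Vx]]] [Ay [d [Ad cd Vy]]]; split; first exact: subM.
  exists (c * d); split; first exact: subM.
    exact: (@contractsM _ bG (aut_inv a)).
  by have := subM sV (onormal_conjV d oV Vx) Vy; grp.
- move=> x [Ax [c [Ac cc Vx]]]; split; first exact: subV.
  exists c^-1; split; first exact: subV.
    exact: (@contractsV _ bG (aut_inv a)).
  by have := subV sV (onormal_sym oV Vx); grp.
Qed.

Lemma unstableV x : A x -> V x -> unstable_nbhs x.
Proof.
move=> Ax Vx; split=> //; exists 1; split; first exact: sub1g.
  exact: (@contracts1 _ (aut_inv a)).
by grp.
Qed.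

Lemma unstable_f x : unstable_nbhs x -> unstable_nbhs (a x).
Proof.
move=> Rx; have [c [z [Ac cc Az e Vz]]] := unstable_split Rx.
split; first by apply: csub_f => //; case: Rx.
exists (a c); split; first exact: csub_f.
  exact: (@contracts_iterV _ (aut_inv a) _ 1).
have -> : (a c)^-1 * a x = a z by rewrite e af_morph; grp.
exact: (Vz 1%N).
Qed.

(** Backward iteration may move the error out of [V]; the pigeonhole lemma derives backward from
    forward invariance. *)
Lemma unstable_g k x : unstable_nbhs x -> unstable_nbhs (iter k (ainv a) x).
Proof.
move=> Rx; elim: k => //= k IH; have [_ oV' _] := oV.
apply: (backward_invariant unstable_sub cA sV oV' unstableV unstable_f).
  by apply: csub_g => //; case: IH.
by rewrite ainv_K.
Qed.

End UnstableSubgroup.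

(** Time reversal exchanges the two factors, so [x^-1] is split and the factors are inverted. *)
Lemma splits_inv a V A : is_subgroup A -> is_subgroup V ->
  splits a V A -> splits (aut_inv a) V A.
Proof.
move=> sA sV sVA x Ax Vx.
have [y [z [Ay Az e Vy Vz]]] := sVA _ (subV sA Ax) (subV sV Vx).
exists z^-1, y^-1; split; try exact: subV.
- by rewrite -tg_invM -e tg_invK.
- by move=> k; rewrite [iter _ _ _]iter_autV; apply: subV => //; exact: Vz.
- by move=> k; rewrite [iter _ _ _]iter_autV; apply: subV => //; exact: Vy.
Qed.

(* Splice [x] on the times [-k..k] with a point asymptotic to [1] in the past
   and with one asymptotic to [1] in the future. *)
Lemma homoclinic_dense a V A x : onormal V -> expansive a V -> csub a A ->
  splits a V A -> unstable_nbhs a A V x -> unstable_nbhs (aut_inv a) A V x ->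
  nub a A x.
Proof.
move=> oV eV cA sVA Rx Sx; have sA := csub_sub cA; have [sV oV' _] := oV.
have bG := expansive_basis oV eV.
have eV' := expansive_inv eV; have cA' := csub_inv cA.
have sVA' := splits_inv sA sV sVA.
apply: (closure_window oV eV) => m.
have [c [z [Ac cc Az xE Vz]]] := unstable_split oV eV cA sVA
  (unstable_g oV eV cA sVA m Rx).
(* This gives [x = c1 * w] with [c1] asymptotic to 1 in the past and [w] in [V] at all times
   [>= -m]. *)
pose c1 := iter m a c; pose w := iter m a z.
have xE1 : x = c1 * w.
  by rewrite -iter_autM -xE iter_aut_invVK // subnn.
have [Ac1 Aw] : A c1 /\ A w by split; exact: csub_iter.
have cc1 : contracts (ainv a) c1 by exact: (@contracts_iterV _ (aut_inv a)).
have Sc : unstable_nbhs (aut_inv a) A V (iter m a c1).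
  have -> : c1 = x * w^-1 by rewrite xE1; grp.
  rewrite iter_autM; apply: (subM (unstable_sub oV eV' cA')).
    exact: (unstable_g oV eV' cA' sVA' m Sx).
  apply: (unstableV cA').
    by apply: csub_iter => //; exact: subV.
  by rewrite iter_autV; apply: subV => //; rewrite -iterD; exact: Vz.
have [d [u [Ad cd Au dE Vu]]] := unstable_split oV eV' cA' sVA' Sc.
(* Here [a^m c1 = d * u] with [d] contracted by [a] and [u] in [V] at all times [<= 0]. So [x] is
   [a^-m d] times [a^-m u * w], and both of these last factors are in [V] at the times from [-m] to
   [m]. *)
exists (iter m (ainv a) d).
  split; first exact: csub_iterV.
    exact: contracts_iterV.
  apply: (@contracts_iter _ (aut_inv a)).
  have -> : d = iter m a c1 * u^-1 by rewrite dE; grp.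
  apply: (@contractsM _ bG (aut_inv a)).
    exact: (@contracts_iterV _ (aut_inv a)).
  by apply: (@contractsV _ bG (aut_inv a)); exact: (contracts_past oV eV).
have -> : x^-1 * iter m (ainv a) d =
    (iter m (ainv a) u * w)^-1.
  have -> : x = iter m (ainv a) d * (iter m (ainv a) u * w).
    rewrite xE1 tg_mulA; congr (_ * _).
    by rewrite -(iter_autM (aut_inv a)) -dE [iter _ _ _]iter_autK // subnn.
  by grp.
have [sW _ _] := onormal_window a m oV.
apply: (subV sW); apply: (subM sW) => k km; split.
- by rewrite iter_aut_invK //; exact: Vu.
- by rewrite -iterD; exact: Vu.
- by rewrite -iterD; exact: Vz.
- by rewrite iter_autK //; exact: Vz.
Qed.

Lemma nub_rel_open a V A : onormal V -> expansive a V -> csub a A ->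
  rel_open (nub a A) A.
Proof.
move=> oV eV cA; have [V' [oV' eV' sVA]] := exists_splitting cG oV eV cA.
exists V' => // x Ax Vx; apply: (homoclinic_dense oV' eV') => //.
  exact: unstableV.
exact: (unstableV (csub_inv cA)).
Qed.

Lemma orbit_sub a A x : csub a A -> A x -> zorbit a (ainv a) x `<=` A.
Proof.
by move=> cA Ax _ [[k|k] _ <-]; [exact: csub_iter|exact: csub_iterV].
Qed.

Lemma orbit_subE a A x y :
  csub a A -> zorbit a (ainv a) x y -> A y -> A x.
Proof.
move=> cA [[k|k] _ <-] /=.
  by move=> /(csub_iterV k cA); rewrite iter_autK // subnn.
by move=> /(csub_iter k.+1 cA); rewrite (iter_aut_invVK a x (leqnn k.+1)) subnn.
Qed.

(** A dense orbit of [X] enters the neighbourhood [V] of the identity and so meets [Y]. By stability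
    [Y] contains the whole orbit, and being closed it contains [X]. *)
Lemma transitive_rel_open a (X Y : set G) : csub a X -> csub a Y ->
  top_transitive X a (ainv a) -> rel_open Y X -> X `<=` Y.
Proof.
move=> cX cY [x Xx Xcl] [V [sV oV _] VY].
have X1 := sub1g (csub_sub cX).
have [y orby] := closure_coset (Xcl _ X1) oV (sub1g sV); grp => Vy.
have /(orbit_subE cY orby) Yx : Y y by apply: VY => //; exact: orbit_sub orby.
move=> z /Xcl; have clY := csub_closed cY; rewrite [Y](closure_id _).1 //.
by apply: closureS; exact: orbit_sub.
Qed.

End NubOpen.

(** * Topological transitivity of the nub *)

Section NubTransitive.
Context {G : topGroup} (a : aut G) (V A : set G).
Hypothesis cG : compact [set: G].
Hypotheses (oV : onormal V) (eV : expansive a V) (cA : csub a A).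

Let bG : onormal_basis G := expansive_basis cG oV eV.
Local Notation Delta := (homoclinic a A).
Local Notation W := (window a V).
Let sA : is_subgroup A := csub_sub cA.
Let oW n : onormal (W n) := onormal_window a n oV.
Let sW n : is_subgroup (W n).
Proof. by have [] := oW n. Qed.
Let sD : is_subgroup Delta := homoclinic_sub bG a sA.

(* A homoclinic [v] is shifted away to a time where [x] is already near [1]. *)
Lemma visit_list (l : seq G) n x m : (forall v, v \in l -> Delta v) ->
  Delta x -> exists x' m', [/\ Delta x', (m <= m')%N, W m (x^-1 * x') &
    forall y, W m' (x'^-1 * y) -> forall v, v \in l ->
      exists k, W n (v^-1 * iter k a y)].
Proof.
elim: l x m => [|v l IH] x m lD Dx.
  by exists x, m; split=> //; grp; exact: sub1g.
have [Ax ax gx] := Dx; have [Av av gv] := lD v (mem_head _ _).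
have [p hp] := contractsW (oW n) ax.
have [q hq] := contractsW (a := aut_inv a) (oW m) gv.
pose k := maxn p q.
have Wx : W n (iter k a x) by apply: hp; exact: leq_maxl.
have Wv : W m (iter k (ainv a) v) by apply: hq; exact: leq_maxr.
(* This point is near [x] at time 0 and near [v] at time [k]. The radius [k + n] below keeps the
   second property, to precision [n], under the later perturbations. *)
have Dx1 : Delta (x * iter k (ainv a) v).
  apply: subM => //; split; first exact: csub_iterV.
    exact: contracts_iterV.
  exact: (@contracts_iter _ (aut_inv a)).
have [|x' [m' [Dx' mm' Wx' vis]]] := IH _ (maxn m (k + n)%N) _ Dx1.
  by move=> u ul; apply: lD; rewrite inE ul orbT.
exists x', m'; split=> //; first exact: leq_trans (leq_maxl _ _) mm'.
  have := subM (sW m) Wv (window_le (leq_maxl _ _) Wx').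
  by grp.
move=> y Wy u; rewrite inE => /orP[/eqP ->|]; last exact: vis.
exists k; have := subM (sW _) Wx' (window_le mm' Wy); grp.
move=> Wxy; have := window_iter (window_le (leq_maxr m (k + n)%N) Wxy).
rewrite !iter_autM !iter_autV.
rewrite iter_aut_invVK // subnn => Wy'.
have := subM (sW n) (onormal_conjV v (oW n) Wx) Wy'.
by grp.
Qed.

(** Homoclinic points are dense in the nub, and finitely many of them represent all homoclinic
    points modulo [W n]; it is enough to visit these. *)
Lemma visit_all n x m : Delta x -> exists x' m',
  [/\ Delta x', (m <= m')%N, W m (x^-1 * x') &
    forall y, W m' (x'^-1 * y) -> forall d, nub a A d ->
      exists k, W n (d^-1 * iter k a y)].
Proof.
move=> Dx; have [_ oWn _] := oW n.
have [T TD cT] := coset_cover_in cG sD (sW n) oWn.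
have [x' [m' [Dx' mm' Wx' vis]]] := visit_list n m TD Dx.
exists x', m'; split=> // y Wy d nd.
have [e De We] := nubW nd (oW n); have [t tT Wt] := cT e De.
have [k Wk] := vis y Wy t tT; exists k.
by have := subM (sW n) We (subM (sW n) (subV (sW n) Wt) Wk); grp.
Qed.

Lemma nub_transitive : top_transitive (nub a A) a (ainv a).
Proof.
have /choice[F FP] : forall s : nat * (G * nat), exists s' : G * nat,
    Delta s.2.1 ->
    [/\ Delta s'.1, (s.2.2 <= s'.2)%N, W s.2.2 (s.2.1^-1 * s'.1) &
    forall y, W s'.2 (s'.1^-1 * y) -> forall d, nub a A d ->
      exists k, W s.1 (d^-1 * iter k a y)].
  move=> [n [x m]] /=.
  have [Dx|nDx] := pselect (Delta x); last by exists (x, m).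
  by have [x' [m' h]] := visit_all n m Dx; exists (x', m').
(* Stage [n + 1] refines stage [n] so as to visit the whole nub to precision [n]. The closed
   neighbourhoods decrease, and the orbit of a common point is dense. *)
pose fix st n := if n is k.+1 then F (k, st k) else (1, 0%N).
have Dst n : Delta (st n).1.
  elim: n => [|n IH]; first exact: (sub1g sD).
  by have [] := FP (n, st n) IH.
have [|||n|x nx xP] := @decreasing_closed_meet _ (nub a A)
    (fun n => [set y | W (st n).2 ((st n).1^-1 * y)]).
- by apply: subclosed_compact cG _ => //; exact: closed_closure.
- move=> n; apply: (closed_preim (@mulgl_cont _ _)).
  by have [? ? _] := oW (st n).2; exact: open_subgroup_closed.
- move=> n y /= Wy; have [_ le Wst _] := FP (n, st n) (Dst n).
  by have := subM (sW _) Wst (window_le le Wy); grp.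
- exists (st n).1; first exact/subset_closure/Dst.
  by rewrite /= tg_mulVg; exact: sub1g.
exists x => // d nd; apply: (closure_window cG oV eV) => m.
have [_ _ _ vis] := FP (m, st m) (Dst m).
have [k Wk] := vis x (xP m.+1) d nd.
by exists (iter k a x) => //; exists (Posz k).
Qed.

End NubTransitive.

(** * Quotient groups *)

Section CosetSpace.
Local Open Scope quotient_scope.
Context {G : topGroup}.
Implicit Types (x y : G) (N W : set G).

Definition cos N x : coset_space N := \pi_({eq_quot (coset_rel N)}) x.

Definition rp N (X : coset_space N) : G := repr (X : {eq_quot (coset_rel N)}).

Lemma cos_rp N (X : coset_space N) : cos N (rp X) = X.
Proof. exact: reprK. Qed.

Lemma cosP N x y : is_subgroup N -> cos N x = cos N y <-> N (x^-1 * y).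
Proof.
move=> sN; rewrite /cos; split.
  move=> /eqmodP /asboolP h.
  have [n Nn <-] : lcoset x N y by rewrite h; exists 1; [exact: sub1g|grp].
  by grp.
move=> Nxy; apply/eqmodP/asboolP/seteqP; split=> [_ [n Nn <-]|_ [n Nn <-]].
  exists ((x^-1 * y)^-1 * n); first exact: subVM.
  by grp.
exists (x^-1 * y * n); first exact: subM.
by grp.
Qed.

Lemma cos_continuous N : continuous (cos N).
Proof. exact: (@pi_continuous _ {eq_quot (coset_rel N)}). Qed.

(** The quotient map is open: the preimage of the image of [x W] is a union of translates of [x W]
    by elements of [N]. *)
Lemma nbhs_cos N x (O : set (coset_space N)) : is_subgroup N ->
  onormal_basis G ->
  nbhs (cos N x) O <->
  exists2 W, onormal W & forall w, W w -> O (cos N (x * w)).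
Proof.
move=> sN bG; split=> [|[W oW WO]].
  rewrite nbhsE => -[O' [oO' O'x] O'O].
  have [||W oW WU] := bG [set y | O' (cos N (x * y))].
  - apply: (@open_preim _ _ (tg_mul x) [set y | O' (cos N y)]).
      exact: mulgl_cont.
    exact: (open_preim (@cos_continuous N)).
  - by rewrite /= tg_mulg1.
  by exists W => // w /WU /O'O.
rewrite nbhsE; exists [set X | exists2 w, W w & X = cos N (x * w)]; last first.
  by move=> _ [w Ww ->]; exact: WO.
split; last by exists 1; [case: oW => sW _ _; exact: sub1g | rewrite tg_mulg1].
have -> : open [set X | exists2 w, W w & X = cos N (x * w)] =
    open [set y | exists2 w, W w & cos N y = cos N (x * w)] by [].
have -> : [set y | exists2 w, W w & cos N y = cos N (x * w)] =
    \bigcup_(n in N) [set y | W (x^-1 * (y * n))].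
  apply/seteqP; split=> y.
    move=> [w Ww /(cosP _ _ sN) Nw]; exists (y^-1 * (x * w)) => //=.
    by grp.
  move=> [n Nn /= Wn]; exists (x^-1 * (y * n)) => //; apply/cosP => //.
  by grp.
apply: bigcup_open => n _; case: oW => _ oW _.
apply: (@open_preim _ _ (fun y => y * n) [set y | W (x^-1 * y)]).
  exact: mulgr_cont.
exact: open_coset.
Qed.

Lemma cos_mul N (M : set G) x y x' y' : is_subgroup N -> is_subgroup M ->
  N `<=` M -> normal_in N M -> M x -> M y ->
  cos N x' = cos N x -> cos N y' = cos N y -> cos N (x' * y') = cos N (x * y).
Proof.
move=> sN sM NM nN Mx My /esym/(cosP _ _ sN) Nx /esym/(cosP _ _ sN) Ny.
apply/esym/(cosP _ _ sN).
have := nN _ _ (subV sM My) Nx; grp => Nx'.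
by have := subM sN Nx' Ny; grp.
Qed.

Lemma cos_inv N (M : set G) x x' : is_subgroup N -> is_subgroup M ->
  N `<=` M -> normal_in N M -> M x ->
  cos N x' = cos N x -> cos N x'^-1 = cos N x^-1.
Proof.
move=> sN sM NM nN Mx /(cosP _ _ sN) Nx; apply/(cosP _ _ sN).
by have := nN _ _ Mx Nx; grp => /(subV sN); grp.
Qed.

Lemma cos_aut (a : aut G) N x x' : csub a N ->
  cos N x' = cos N x -> cos N (a x') = cos N (a x).
Proof.
move=> cN; have sN := csub_sub cN; move=> /(cosP _ _ sN) /(csub_f cN).
by rewrite af_morph autV => /(cosP _ _ sN).
Qed.

End CosetSpace.

Section QuotientGroup.
Context {G : topGroup} (a : aut G) (N M : set G).
Hypotheses (cG : compact [set: G]) (bG : onormal_basis G).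
Hypotheses (cN : csub a N) (cM : csub a M) (NM : N `<=` M) (nN : normal_in N M).
Let sN : is_subgroup N := csub_sub cN.
Let sM : is_subgroup M := csub_sub cM.

(** The same subspace of [G / N] as in [subquotient], made a type so that it can carry a
    [topGroup]. *)
Definition qcarrier : topologicalType := set_type (cos N @` M).
Local Notation K := qcarrier.
Implicit Types X Y : K.

Definition qrp X : G := rp (val X).

Lemma cos_qrp X : cos N (qrp X) = val X.
Proof. exact: cos_rp. Qed.

Lemma qrp_mem X : M (qrp X).
Proof.
have [x Mx e] := set_valP X; rewrite -(cos_qrp X) in e.
have /NM Mxy := (cosP _ _ sN).1 e.
exact: subMl (subV sM Mx) Mxy.
Qed.

Lemma mem_cosM x X : val X = cos N x -> M x.
Proof.
move=> e; rewrite -cos_qrp in e; have /NM := (cosP _ _ sN).1 e.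
exact: subMl (subV sM (qrp_mem X)).
Qed.

Definition qmk x (Mx : M x) : K :=
  exist _ (cos N x) (mem_set (ex_intro2 _ _ x Mx erefl)).

Definition qmul X Y : K := qmk (subM sM (qrp_mem X) (qrp_mem Y)).
Definition qone : K := qmk (sub1g sM).
Definition qinv X : K := qmk (subV sM (qrp_mem X)).
Definition qaut X : K := qmk (csub_f cM (qrp_mem X)).
Definition qautV X : K := qmk (csub_g cM (qrp_mem X)).

Lemma val_qmul X Y x y : val X = cos N x -> val Y = cos N y ->
  val (qmul X Y) = cos N (x * y).
Proof.
move=> eX eY; apply: (@cos_mul _ N M) => //; last 2 first.
- by rewrite cos_qrp.
- by rewrite cos_qrp.
- exact: mem_cosM eX.
- exact: mem_cosM eY.
Qed.

Lemma val_qinv X x : val X = cos N x -> val (qinv X) = cos N x^-1.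
Proof.
move=> eX; apply: (@cos_inv _ N M) => //; last by rewrite cos_qrp.
exact: mem_cosM eX.
Qed.

Lemma val_qaut X x : val X = cos N x -> val (qaut X) = cos N (a x).
Proof. by move=> eX; apply: (cos_aut cN); rewrite cos_qrp. Qed.

Lemma val_qautV X x : val X = cos N x -> val (qautV X) = cos N (ainv a x).
Proof. by move=> eX; apply: (cos_aut (csub_inv cN)); rewrite cos_qrp. Qed.

Lemma nbhs_qcarrier X x (O : set K) (W : set G) : onormal W ->
  val X = cos N x ->
  (forall Y w, W w -> val Y = cos N (x * w) -> O Y) -> nbhs X O.
Proof.
move=> oW eX WO.
have cv : continuous (val : K -> coset_space N) by exact: initial_continuous.
have : nbhs (val X) [set Z | exists2 w, W w & Z = cos N (x * w)].
  by rewrite eX; apply/nbhs_cos => //; exists W => // w Ww; exists w.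
move=> /cv h; apply: (@filterS _ (nbhs X) _ _ _ _ h) => Y [w Ww e].
exact: (WO Y w).
Qed.

Lemma qcontinuous (T : topologicalType) (f : T -> K) :
  (forall t x W, onormal W -> val (f t) = cos N x ->
    nbhs t [set t' | exists2 w, W w & val (f t') = cos N (x * w)]) ->
  continuous f.
Proof.
move=> h; apply: continuous_comp_initial => t U nU.
have {nU} : nbhs (cos N (qrp (f t))) U by rewrite cos_qrp; exact: nU.
move=> /(nbhs_cos _ _ sN bG)[W oW WU].
have ht := h t _ W oW (esym (cos_qrp (f t))).
apply: (@filterS _ (nbhs t) _ _ _ _ ht) => t' [w Ww e].
by have := WU w Ww; rewrite -e.
Qed.

Lemma qmul_continuous : continuous (fun p : K * K => qmul p.1 p.2).
Proof.
apply: qcontinuous => -[X Y] z W oW /= ez.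
exists ([set X' | exists2 w, W w & val X' = cos N (qrp X * w)],
        [set Y' | exists2 w, W w & val Y' = cos N (qrp Y * w)]).
  split; apply: (nbhs_qcarrier oW (esym (cos_qrp _))) => Z w Ww e; by exists w.
move=> [X' Y'] [/= [u Wu eX] [v Wv eY]].
have /(cosP _ _ sN) Nz : cos N (qrp X * qrp Y) = cos N z := ez.
have [sW _ _] := oW.
(* With [x], [y] the representatives, [z = x y n] and [n] in [N], one has
   [x u y v = z (n^-1 (y^-1 u y v) n) n^-1]. *)
pose n := (qrp X * qrp Y)^-1 * z.
exists (n^-1 * ((qrp Y)^-1 * u * qrp Y * v) * n).
  by apply: onormal_conjV => //; apply: subM => //; exact: onormal_conjV.
apply: (etrans (val_qmul eX eY)); apply/(cosP _ _ sN).
by have := Nz; rewrite /n; grp.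
Qed.

Lemma qinv_continuous : continuous qinv.
Proof.
apply: qcontinuous => X z W oW ez.
apply: (nbhs_qcarrier oW (esym (cos_qrp X))) => Y w Ww eY.
have /(cosP _ _ sN) Nz : cos N (qrp X)^-1 = cos N z := ez.
have [sW _ nW] := oW.
exists ((qrp X * z)^-1 * (qrp X * w^-1 * (qrp X)^-1) * (qrp X * z)).
  by apply: onormal_conjV => //; apply: nW; exact: subV.
apply: (etrans (val_qinv eY)); apply/(cosP _ _ sN).
by have := Nz; grp.
Qed.

Lemma qaut_continuous : continuous qaut.
Proof.
apply: qcontinuous => X z W oW ez.
apply: (nbhs_qcarrier (onormal_iter a 1 oW) (esym (cos_qrp X))) => Y w Ww eY.
have /(cosP _ _ sN) Nz : cos N (a (qrp X)) = cos N z := ez.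
exists (((a (qrp X))^-1 * z)^-1 * a w * ((a (qrp X))^-1 * z)).
  exact: onormal_conjV.
apply: (etrans (val_qaut eY)); rewrite af_morph; apply/(cosP _ _ sN).
by have := Nz; grp.
Qed.

(** As [N] is closed, some open normal [W] keeps [x^-1 y W] away from [N], and then the images of
    [x W] and [y W] are disjoint. *)
Lemma qhausdorff : hausdorff_space K.
Proof.
move=> X Y clXY; apply: val_inj; rewrite -(cos_qrp X) -(cos_qrp Y).
apply/(cosP _ _ sN); apply: contrapT => nNxy.
have [||W oW WN] := @bG [set w | ~ N ((qrp X)^-1 * qrp Y * w)].
- apply: (@open_preim _ _ (tg_mul ((qrp X)^-1 * qrp Y)) (~` N)).
    exact: mulgl_cont.
  exact: closed_openC (csub_closed cN).
- by rewrite /= tg_mulg1.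
have [||Z [[u Wu eX] [v Wv eY]]] := clXY
    [set Z | exists2 w, W w & val Z = cos N (qrp X * w)]
    [set Z | exists2 w, W w & val Z = cos N (qrp Y * w)].
- by apply: (nbhs_qcarrier oW (esym (cos_qrp X))) => Z w Ww e; exists w.
- by apply: (nbhs_qcarrier oW (esym (cos_qrp Y))) => Z w Ww e; exists w.
have /(cosP _ _ sN) : cos N (qrp X * u) = cos N (qrp Y * v) by rewrite -eX.
pose c := (qrp X)^-1 * qrp Y; have [sW _ _] := oW.
have Wc : W (c^-1 * u^-1 * c * v).
  by apply: subM => //; apply: onormal_conjV => //; exact: subV.
by have := WN _ Wc; rewrite /= /c; grp.
Qed.

Lemma qcompact : compact [set: K].
Proof.
have cQ : compact (cos N @` M).
  apply: continuous_compact.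
    by apply: continuous_subspaceT; exact: cos_continuous.
  by apply: subclosed_compact cG _ => //; exact: csub_closed cM.
move=> F FF _; have [|_ [[x Mx <-] clx]] := cQ (val @ F) _.
  by apply: (@filterS _ F _ setT) => [X _|]; [exact: set_valP | exact: filterT].
exists (qmk Mx); split=> // A B FA /= [_ [[O oO <-] Ox] OB].
have FvA : F [set X : K | ((val : K -> coset_space N) @` A) (val X)].
  by apply: filterS FA => X AX; exists X.
have [_ [[X AX <-] OX]] := clx _ O FvA (open_nbhs_nbhs (conj oO Ox)).
by exists X; split=> //; apply: OB.
Qed.

Lemma qmulA : associative qmul.
Proof.
move=> X Y Z; apply: val_inj.
have [eX eY] := (esym (cos_qrp X), esym (cos_qrp Y)).
have eZ := esym (cos_qrp Z).
rewrite (val_qmul eX (val_qmul eY eZ)) (val_qmul (val_qmul eX eY) eZ).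
by rewrite tg_mulA.
Qed.

Lemma qmul1 : left_id qone qmul.
Proof.
move=> X; apply: val_inj.
rewrite (val_qmul (erefl : val qone = cos N 1) (esym (cos_qrp X))).
by rewrite tg_mul1g cos_qrp.
Qed.

Lemma qmulV : left_inverse qone qinv qmul.
Proof.
move=> X; apply: val_inj; have eX := esym (cos_qrp X).
by rewrite (val_qmul (val_qinv eX) eX) tg_mulVg.
Qed.

Definition quotient_group : topGroup :=
  TopGroup qmulA qmul1 qmulV qmul_continuous qinv_continuous qhausdorff.

End QuotientGroup.

(** * Surjections with finite kernel between quotients *)

Section QuotientOnto.
Context {G : topGroup} (a : aut G) (N M : set G).
Hypotheses (cG : compact [set: G]) (bG : onormal_basis G).
Hypotheses (cN : csub a N) (cM : csub a M) (NM : N `<=` M) (nN : normal_in N M).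
Let sN : is_subgroup N := csub_sub cN.
Let sM : is_subgroup M := csub_sub cM.
Local Notation K := (quotient_group bG cN cM NM nN).

Definition quotient_aut : aut K.
Proof.
apply: (@Aut K (qaut cN cM NM) (qautV cN cM NM)).
- move=> X; apply: val_inj.
  rewrite (val_qautV _ _ _ (val_qaut cN cM NM (esym (cos_qrp X)))) af_K.
  exact: cos_qrp.
- move=> X; apply: val_inj.
  rewrite (val_qaut _ _ _ (val_qautV cN cM NM (esym (cos_qrp X)))) ainv_K.
  exact: cos_qrp.
- move=> X Y; apply: val_inj.
  have [eX eY] := (esym (cos_qrp X), esym (cos_qrp Y)).
  rewrite (val_qaut cN cM NM (val_qmul cN cM NM nN eX eY)) af_morph.
  have [eaX eaY] := (val_qaut cN cM NM eX, val_qaut cN cM NM eY).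
  by rewrite (val_qmul cN cM NM nN eaX eaY).
- exact: qaut_continuous.
- have -> : qautV cN cM NM = qaut (csub_inv cN) (csub_inv cM) NM.
    by apply/funext => X; exact: val_inj.
  exact: qaut_continuous.
Defined.

(** The map sends a coset of [N] to the coset of [N'] containing it. Its kernel is the image of
    [M & N'], finite because [N] contains a neighbourhood of 1 in [M & N']. *)
Lemma quotient_onto (N' M' : set G) : csub a N' -> csub a M' ->
  N' `<=` M' -> normal_in N' M' -> N `<=` N' -> M `<=` M' ->
  (forall x, M' x -> exists2 y, M y & N' (x^-1 * y)) ->
  rel_open N (M `&` N') ->
  let D := subquotient a N' M' in
  exists p : K -> sq_T D,
  [/\ continuous p, p @` setT = sq_S D,
      forall x y, p (tg_mul x y) = sq_mul D (p x) (p y),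
      finite_set [set k | p k = sq_one D] &
      forall k, p (quotient_aut k) = sq_f D (p k)].
Proof.
move=> cN' cM' N'M' nN' NN' MM' onto [V oV VN] D.
have [sN' sM'] := (csub_sub cN', csub_sub cM').
pose p (X : K) : sq_T D := cos N' (qrp X).
have pE (X : K) x : val X = cos N x -> p X = cos N' x.
  move=> e; apply/(cosP _ _ sN')/NN'/(cosP _ _ sN).
  by rewrite -e; exact: cos_qrp.
exists p; split.
- move=> X U /(nbhs_cos _ _ sN' bG)[W oW WU].
  apply: (nbhs_qcarrier bG cN oW (esym (cos_qrp X))) => Y w Ww /pE e.
  by rewrite /= e; exact: WU.
- apply/seteqP; split=> [_ [X _ <-]|_ [x M'x <-]].
    by exists (qrp X) => //; apply: MM'; exact: qrp_mem cN cM NM X.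
  have [y My N'xy] := onto x M'x; exists (qmk N My) => //.
  rewrite (@pE _ y) //; apply/esym/(cosP _ _ sN'); exact: N'xy.
- move=> X Y; have M'rp (Z : K) : M' (qrp Z).
    by apply: MM'; exact: qrp_mem cN cM NM Z.
  have [eX eY] := (esym (cos_qrp X), esym (cos_qrp Y)).
  rewrite (pE _ _ (val_qmul cN cM NM nN eX eY)).
  apply/esym; apply: (@cos_mul _ N' M') => //; exact: cos_rp.
- have [sV openV _] := oV.
  have sMN : is_subgroup (M `&` N') by exact: subgroupI.
  have [T TM cT] := coset_cover_in cG sMN sV openV.
  have /choice[f fP] : forall x, exists X : K, M x -> val X = cos N x.
    move=> x; have [Mx|nMx] := pselect (M x); first by exists (qmk N Mx).
    by exists (1 : K).
  apply: (@sub_finite_set _ _ (f @` [set` T])); last first.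
    by apply: finite_image; exact: finite_seq.
  move=> X /esym/(cosP _ _ sN'); grp => N'X.
  have MX := qrp_mem cN cM NM X.
  have [t tT Vt] := cT (qrp X) (conj MX N'X).
  have [Mt N't] := TM t tT.
  exists t => //; apply: val_inj; rewrite fP // -cos_qrp.
  by apply/(cosP _ _ sN)/VN => //; split; exact: subVM.
- move=> X; rewrite (pE _ _ (val_qaut cN cM NM (esym (cos_qrp X)))).
  by apply/esym; apply: (cos_aut cN'); exact: cos_rp.
Qed.

End QuotientOnto.

(** * Zassenhaus' lemma *)

Definition mulset (G : topGroup) (A B : set G) : set G :=
  [set x | exists2 y, A y & B (y^-1 * x)].

Section Products.
Context {G : topGroup} (a : aut G).
Hypothesis cG : compact [set: G].
Implicit Types (x y : G) (A B X Y : set G).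

Lemma csub_setI A B : csub a A -> csub a B -> csub a (A `&` B).
Proof.
move=> [sA clA fA gA] [sB clB fB gB]; split; first exact: subgroupI.
- exact: closedI.
- by move=> x [? ?]; split; [exact: fA | exact: fB].
- by move=> x [? ?]; split; [exact: gA | exact: gB].
Qed.

Lemma mulset_closed A B : closed A -> closed B -> closed (mulset A B).
Proof.
move=> clA clB; apply: compact_closed; first exact: tg_hausdorff.
have -> : mulset A B = (fun p : G * G => p.1 * p.2) @` (A `*` B).
  apply/seteqP; split=> [x [y Ay Byx]|_ [[y z] [/= Ay Bz] <-]].
    by exists (y, y^-1 * x) => //=; grp.
  by exists y => //; grp.
apply: continuous_compact.
  by apply: continuous_subspaceT; exact: tg_mul_cont.
by apply: compact_setX; apply: subclosed_compact cG _.
Qed.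

Lemma csub_mulset A B : csub a A -> csub a B ->
  (forall b x, B b -> A x -> A (b * x * b^-1)) -> csub a (mulset A B).
Proof.
move=> [sA clA fA gA] [sB clB fB gB] nAB; split.
- exact: subgroup_normal_mul.
- exact: mulset_closed.
- move=> x [y /fA Ay /fB]; rewrite af_morph autV => By.
  by exists (a y).
- move=> x [y /gA Ay /gB].
  rewrite ainvM ainvV => By.
  by exists (ainv a y).
Qed.

Lemma mulsetC A B : is_subgroup A -> is_subgroup B ->
  is_subgroup (mulset A B) -> mulset A B = mulset B A.
Proof.
move=> sA sB sAB; apply/seteqP; split=> x.
  move=> /(subV sAB)[y Ay By]; exists ((y^-1 * x^-1)^-1); first exact: subV.
  by have := subV sA Ay; grp.
move=> [y By Ay]; apply: (subVE sAB).
by exists (y^-1 * x)^-1; [exact: subV | have := subV sB By; grp].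
Qed.

(** Among the finitely many closed cosets [t Y], those with [t] outside [Y] miss the identity, so
    some open normal [W] avoids them all. *)
Lemma finite_index_rel_open X Y (T : seq G) : onormal_basis G ->
  is_subgroup Y -> closed Y ->
  (forall x, X x -> exists2 t, t \in T & Y (t^-1 * x)) -> rel_open Y X.
Proof.
move=> bG sY clY XT.
have [W oW WT] : exists2 W, onormal W &
    forall t, t \in T -> ~ Y t -> forall w, W w -> ~ Y (t^-1 * w).
  elim: T {XT} => [|t T [W oW WT]]; first by exists setT => //; exact: onormalT.
  have [Yt|nYt] := pselect (Y t).
    by exists W => // u; rewrite inE => /orP[/eqP->|/WT].
  have [||W' oW' W'T] := bG [set w | ~ Y (t^-1 * w)].
  - apply: (@open_preim _ _ (tg_mul t^-1) (~` Y)); first exact: mulgl_cont.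
    exact: closed_openC.
  - by rewrite /= tg_mulg1 => /(subVE sY).
  exists (W `&` W'); first exact: onormalI.
  move=> u; rewrite inE => /orP[/eqP-> _ w [_ /W'T]//|uT nYu w [Ww _]].
  exact: WT.
exists W => // x Xx Wx; have [t tT Yx] := XT x Xx.
have [Yt|nYt] := pselect (Y t); first by have := subM sY Yt Yx; grp.
by case: (WT t tT nYt x Wx).
Qed.

End Products.

Section Zassenhaus.
Context {G : topGroup} (a : aut G) (V : set G).
Hypothesis cG : compact [set: G].
Hypotheses (oV : onormal V) (eV : expansive a V).
Let bG : onormal_basis G := expansive_basis cG oV eV.

Lemma nub_transitive_id A :
  csub a A -> top_transitive A a (ainv a) -> nub a A = A.
Proof.
move=> cA tA; apply/seteqP; split; first exact: nub_subset (csub_closed cA).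
apply: (transitive_rel_open cA _ tA (nub_rel_open cG oV eV cA)).
exact: nub_csub.
Qed.

Lemma csub_good A : good_subgroup a A -> csub a A.
Proof.
move=> [sA clA stA _]; split=> //.
  by move=> x Ax; rewrite -stA; exists x.
by move=> x; rewrite -{1}stA => -[y Ay <-]; rewrite af_K.
Qed.

Lemma nub_good_id A : good_subgroup a A -> nub a A = A.
Proof.
by move=> gA; apply: nub_transitive_id; [exact: csub_good | case: gA].
Qed.

Lemma good_nub A : csub a A -> good_subgroup a (nub a A).
Proof.
move=> cA; have [sN clN fN gN] := nub_csub bG cA.
split=> //; last exact: nub_transitive cG oV eV cA.
apply/seteqP; split=> [_ [x Nx <-]|x Nx]; first exact: fN.
by exists (ainv a x); [exact: gN | rewrite ainv_K].
Qed.

Lemma subquotient_transitive A B : csub a A -> good_subgroup a B ->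
  sq_top_transitive (subquotient a A B).
Proof.
move=> cA [_ _ _ [x Bx Bcl]]; pose D := subquotient a A B.
exists (cos A x); first by exists x.
move=> _ [y By <-] O /(@cos_continuous _ A y) /(Bcl y By) [_ [[k _ <-] Oz]].
exists (cos A (zpowf a (ainv a) k x)); split=> //; exists k => //.
have fE z : sq_f D (cos A z) = cos A (a z).
  by apply: (cos_aut cA); exact: cos_rp.
have gE z : sq_finv D (cos A z) = cos A (ainv a z).
  by apply: (cos_aut (csub_inv cA)); exact: cos_rp.
case: k {Oz} => k /=; first by elim: k => //= k ->; exact: fE.
by rewrite -gE; congr (sq_finv D _); elim: k => //= k ->; exact: gE.
Qed.

(** One half of the Zassenhaus comparison, for [X1 = X0 D] and [E = D & X0]. The product of [nub X0]
    and [nub D] has finite index in [X1], hence contains the transitive group [nub X1]. *)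
Lemma nub_quotient_onto D E X0 X1 (cD : csub a D) (cE : csub a E)
    (NM : nub a E `<=` nub a D) (nN : normal_in (nub a E) (nub a D)) :
  csub a X0 -> csub a X1 -> X0 `<=` X1 -> normal_in X0 X1 ->
  E `<=` X0 -> D `<=` X1 -> X1 `<=` mulset X0 D -> D `&` X0 `<=` E ->
  let Q := quotient_group bG (nub_csub bG cE) (nub_csub bG cD) NM nN in
  let S := subquotient a (nub a X0) (nub a X1) in
  exists p : Q -> sq_T S,
  [/\ continuous p, p @` setT = sq_S S,
      forall x y, p (tg_mul x y) = sq_mul S (p x) (p y),
      finite_set [set k | p k = sq_one S] &
      forall k, p (quotient_aut bG (nub_csub bG cE) (nub_csub bG cD) NM nN k)
        = sq_f S (p k)].
Proof.
move=> cX0 cX1 X01 nX EX0 DX1 X1D DX0E Q S.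
have [cnX0 cnX1] := (nub_csub bG cX0, nub_csub bG cX1).
have [cnD cnE] := (nub_csub bG cD, nub_csub bG cE).
have nubS A : csub a A -> nub a A `<=` A.
  by move=> cA; exact: nub_subset (csub_closed cA).
have nnX : normal_in (nub a X0) X1 by exact: nub_normal.
pose Y := mulset (nub a X0) (nub a D).
have cY : csub a Y.
  by apply: csub_mulset => // b x /(nubS _ cD)/DX1; exact: nnX.
have oY : rel_open Y (nub a X1).
  have [V0 [sV0 oV0 _] VX0] := nub_rel_open cG oV eV cX0.
  have [V1 [sV1 oV1 _] VD] := nub_rel_open cG oV eV cD.
  have [sX0 sD] := (csub_sub cX0, csub_sub cD).
  have [T0 T0X cT0] := coset_cover_in cG sX0 sV0 oV0.
  have [T1 T1D cT1] := coset_cover_in cG sD sV1 oV1.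
  (* For [x = y d] with [y] in [s nub X0] and [d] in [t nub D], [(s t)^-1 x] is the product of
     [t^-1 (s^-1 y) t] and [t^-1 d]; the first is in [nub X0] by normality. *)
  apply: (@finite_index_rel_open _ _ _ [seq s * t | s <- T0, t <- T1]) => //.
  - exact: csub_sub cY.
  - exact: csub_closed cY.
  move=> x /(nubS _ cX1)/X1D [y X0y Dyx].
  have [s sT Vs] := cT0 y X0y; have [t tT Vt] := cT1 _ Dyx.
  exists (s * t); first by apply: allpairs_f.
  have nsy : nub a X0 (s^-1 * y).
    by apply: VX0 => //; apply: subVM => //; exact: T0X.
  exists (t^-1 * (s^-1 * y) * t^-1^-1).
    apply: nnX => //; apply: subV; first exact: csub_sub cX1.
    by apply: DX1; exact: T1D.
  have : nub a D (t^-1 * (y^-1 * x)).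
    by apply: VD => //; apply: subVM => //; exact: T1D.
  by grp.
apply: quotient_onto => //.
- exact: nub_mono.
- by move=> b x /(nubS _ cX1); exact: nnX.
- exact: nub_mono.
- exact: nub_mono.
- move=> x nx; have [] := good_nub cX1 => _ _ _ tX1.
  have [y ny nyx] := transitive_rel_open cnX1 cY tX1 oY nx.
  exists (y^-1 * x) => //.
  have X1x := subV (csub_sub cX1) (nubS _ cX1 _ nx).
  by have := nnX _ _ X1x (subV (csub_sub cnX0) ny); grp.
- have [U oU UE] := nub_rel_open cG oV eV cE; exists U => // x [nDx nX0x].
  by apply: UE; apply: DX0E; split; [exact: nubS nDx | exact: nubS nX0x].
Qed.

Definition zass (P0 P1 Q : set G) : set G := mulset P0 (P1 `&` Q).

Section Butterfly.
Context (P0 P1 Q0 Q1 : set G).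
Hypotheses (cP0 : csub a P0) (cP1 : csub a P1).
Hypotheses (cQ0 : csub a Q0) (cQ1 : csub a Q1).
Hypotheses (P01 : P0 `<=` P1) (nP : normal_in P0 P1).
Hypotheses (Q01 : Q0 `<=` Q1) (nQ : normal_in Q0 Q1).

Let sP0 := csub_sub cP0.
Let sP1 := csub_sub cP1.
Let sQ0 := csub_sub cQ0.
Let sQ1 := csub_sub cQ1.

Lemma csub_zass Q : csub a Q -> csub a (zass P0 P1 Q).
Proof.
move=> cQ; apply: csub_mulset => //; first exact: csub_setI.
by move=> b x [P1b _]; exact: nP.
Qed.

Lemma zass_mono : zass P0 P1 Q0 `<=` zass P0 P1 Q1.
Proof. by move=> x [y Py [? /Q01 ?]]; exists y. Qed.

(** An element of the larger group is a product of an element of [P0], which lies in the smaller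
    group, and one of [P1 & Q1], which normalizes both [P0] and [P1 & Q0]. *)
Lemma zass_normal : normal_in (zass P0 P1 Q0) (zass P0 P1 Q1).
Proof.
have sZ := csub_sub (csub_zass cQ0).
have nD d x : (P1 `&` Q1) d -> zass P0 P1 Q0 x -> zass P0 P1 Q0 (d * x * d^-1).
  move=> [P1d Q1d] [y P0y [P1z Q0z]]; exists (d * y * d^-1); first exact: nP.
  split; last by have := nQ Q1d Q0z; grp.
  by have := subM sP1 (subM sP1 P1d P1z) (subV sP1 P1d); grp.
move=> b x [y P0y Dyb] Zx; have Zc := nD _ _ Dyb Zx.
have Zy : zass P0 P1 Q0 y by exists y => //; grp; split; exact: sub1g.
by have := subMV sZ (subM sZ Zy Zc) Zy; grp.
Qed.

Definition zass_ker := mulset (P0 `&` Q1) (P1 `&` Q0).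

Lemma csub_zass_ker : csub a zass_ker.
Proof.
apply: csub_mulset => //; try exact: csub_setI.
move=> b x [P1b Q0b] [P0x Q1x]; split; first exact: nP.
by apply: subMV => //; [apply: subM => // |]; exact: Q01.
Qed.

Lemma zass_ker_subset : zass_ker `<=` P1 `&` Q1.
Proof.
move=> x [y [P0y Q1y] [P1z Q0z]]; split.
  by apply: (subMl sP1 _ P1z); apply: subV => //; exact: P01.
by apply: (subMl sQ1 (subV sQ1 Q1y)); exact: Q01.
Qed.

Lemma zass_ker_normal : normal_in zass_ker (P1 `&` Q1).
Proof.
move=> b x [P1b Q1b] [y [P0y Q1y] [P1z Q0z]].
exists (b * y * b^-1).
  split; first exact: nP.
  by apply: subMV => //; exact: subM.
split; last by have := nQ Q1b Q0z; grp.
by have := subM sP1 (subM sP1 P1b P1z) (subV sP1 P1b); grp.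
Qed.

Lemma zass_ker_sub : zass_ker `<=` zass P0 P1 Q0.
Proof. by move=> x [y [P0y _] h]; exists y. Qed.

Lemma sub_zass : P1 `&` Q1 `<=` zass P0 P1 Q1.
Proof. by move=> x h; exists 1; [exact: sub1g | grp]. Qed.

Lemma zass_mulset : zass P0 P1 Q1 `<=` mulset (zass P0 P1 Q0) (P1 `&` Q1).
Proof.
move=> x [y P0y h]; exists y => //; exists y => //; grp.
by split; exact: sub1g.
Qed.

Lemma zass_kerP : (P1 `&` Q1) `&` zass P0 P1 Q0 `<=` zass_ker.
Proof.
move=> x [[P1x Q1x] [y P0y [P1z Q0z]]]; exists y => //; split=> //.
by have := subMV sQ1 Q1x (Q01 Q0z); grp.
Qed.

End Butterfly.

(** A product of two subgroups that is itself a subgroup is unchanged when the factors are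
    exchanged. Hence both sides of the comparison divide by the same group. *)
Lemma zass_kerC P0 P1 Q0 Q1 :
  csub a P0 -> csub a P1 -> csub a Q0 -> csub a Q1 ->
  P0 `<=` P1 -> normal_in P0 P1 -> Q0 `<=` Q1 -> normal_in Q0 Q1 ->
  zass_ker Q0 Q1 P0 P1 = zass_ker P0 P1 Q0 Q1.
Proof.
move=> cP0 cP1 cQ0 cQ1 P01 nP Q01 nQ.
rewrite /zass_ker [Q0 `&` P1]setIC [Q1 `&` P0]setIC mulsetC //.
- exact: (csub_sub (csub_setI cP1 cQ0)).
- exact: (csub_sub (csub_setI cP0 cQ1)).
- have := csub_sub (csub_zass_ker cQ0 cQ1 cP0 cP1 nQ P01).
  by rewrite /zass_ker [Q0 `&` P1]setIC [Q1 `&` P0]setIC.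
Qed.

Lemma zassenhaus P0 P1 Q0 Q1 :
  csub a P0 -> csub a P1 -> csub a Q0 -> csub a Q1 ->
  P0 `<=` P1 -> normal_in P0 P1 -> Q0 `<=` Q1 -> normal_in Q0 Q1 ->
  cocommensurable
    (subquotient a (nub a (zass P0 P1 Q0)) (nub a (zass P0 P1 Q1)))
    (subquotient a (nub a (zass Q0 Q1 P0)) (nub a (zass Q0 Q1 P1))).
Proof.
move=> cP0 cP1 cQ0 cQ1 P01 nP Q01 nQ.
pose D := P1 `&` Q1; pose E := zass_ker P0 P1 Q0 Q1.
have cD : csub a D by exact: csub_setI.
have cE : csub a E by exact: csub_zass_ker.
have ED : E `<=` D by exact: (zass_ker_subset cP1 cQ1 P01 Q01).
have nED : normal_in E D by exact: (zass_ker_normal cP1 cQ1 nP nQ).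
have NM : nub a E `<=` nub a D by exact: nub_mono.
have nN : normal_in (nub a E) (nub a D).
  move=> b x /(nub_subset (csub_closed cD)); exact: nub_normal.
exists (quotient_group bG (nub_csub bG cE) (nub_csub bG cD) NM nN).
exists (quotient_aut bG (nub_csub bG cE) (nub_csub bG cD) NM nN).
split; first exact: (qcompact cG (nub_csub bG cD)).
have [] := nub_quotient_onto cD cE NM nN (csub_zass cP0 cP1 nP cQ0)
  (csub_zass cP0 cP1 nP cQ1) (zass_mono Q01) (zass_normal cP0 cP1 cQ0 nP nQ)
  (@zass_ker_sub _ _ _ _) (sub_zass cP0) (zass_mulset cP1 cQ0)
  (zass_kerP cQ1 Q01).
move=> p1 p1P.
have eE : zass_ker Q0 Q1 P0 P1 = E by exact: zass_kerC.
have eD : Q1 `&` P1 = D by rewrite setIC.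
have h1 := @zass_ker_sub Q0 Q1 P0 P1; rewrite eE in h1.
have h2 := @sub_zass Q0 Q1 P1 cQ0; rewrite eD in h2.
have h3 := @zass_mulset Q0 Q1 P0 P1 cQ1 cP0; rewrite eD in h3.
have h4 := @zass_kerP Q0 Q1 P0 P1 cP1 P01; rewrite eD eE in h4.
have [p2 p2P] := nub_quotient_onto cD cE NM nN (csub_zass cQ0 cQ1 nQ cP0)
  (csub_zass cQ0 cQ1 nQ cP1) (zass_mono P01) (zass_normal cQ0 cQ1 cP0 nQ nP)
  h1 h2 h3 h4.
by exists p1, p2.
Qed.

End Zassenhaus.

(** [V] is the normal core of [U]. It is open because [U] has finite index, so that finitely many
    conjugates suffice. *)
Lemma finite_depth_expansive (G : topGroup) (a : aut G) :
  compact [set: G] -> finite_depth a ->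
  exists2 V : set G, onormal V & expansive a V.
Proof.
move=> cG [U [sU oU capU]].
pose V : set G := [set x | forall y, U (y^-1 * x * y)].
have sV : is_subgroup V.
  split=> [y|x y Vx Vy z|x Vx z]; first by grp; exact: sub1g.
    by have := subM sU (Vx z) (Vy z); grp.
  by have := subV sU (Vx z); grp.
exists V.
  split=> // [|x y Vx z]; last by have := Vx (y^-1 * z); grp.
  have [T cT] := coset_cover cG sU oU.
  have -> : V = [set x | forall t, t \in T -> U (t^-1 * x * t)].
    apply/seteqP; split=> x /= h; first by move=> t _; exact: h.
    move=> y; have [t tT Ut] := cT y.
    by have := subM sU (subM sU (subV sU Ut) (h t tT)) Ut; grp.
  elim: T {cT} => [|t T IH].
    suff -> : [set x | forall t, t \in [::] -> U (t^-1 * x * t)] = setT.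
      exact: openT.
    by apply/seteqP; split.
  suff -> : [set x | forall u, u \in t :: T -> U (u^-1 * x * u)] =
      [set x | U (t^-1 * x * t)] `&`
      [set x | forall t, t \in T -> U (t^-1 * x * t)].
    apply: openI => //.
    apply: (@open_preim _ _ (tg_mul t^-1) [set x | U (x * t)]).
      exact: mulgl_cont.
    exact: (open_preim (@mulgr_cont _ t)).
  apply/seteqP; split=> x h.
    by split=> [|u uT]; apply: h; rewrite inE ?eqxx ?uT ?orbT.
  by case: h => ht hT u; rewrite inE => /orP[/eqP->//|/hT].
have VU x : V x -> U x by move=> /(_ 1); grp.
move=> x fx gx; suff : [set 1] x by [].
rewrite -capU => -[k|k] _.
  exists (iter k (ainv a) x); first exact: VU.
  by rewrite /= iter_aut_invVK // subnn.
exists (iter k.+1 a x); first exact: VU.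
by rewrite [LHS]iter_autK // subnn.
Qed.

(** * Schreier refinement *)

(** A series prolonged by the whole group, so that the conditions hold without bounds on the
    index. *)
Record chain (G : topGroup) (a : aut G) (r : nat) (s : nat -> set G) : Prop :=
  Chain {
    chain0 : s 0%N = [set 1];
    chainT : forall i, (r <= i)%N -> s i = setT;
    chain_good : forall i, good_subgroup a (s i);
    chainS : forall i, s i `<=` s i.+1;
    chain_normal : forall i, normal_in (s i) (s i.+1) }.

Lemma series_chain (G : topGroup) (a : aut G) r (s : nat -> set G) :
  subnormal_series a r s -> chain a r (fun i => s (minn i r)).
Proof.
move=> [s0 sr good step]; split=> [|i ri|i|i|i].
- by rewrite /= min0n.
- by rewrite /= (minn_idPr ri).
- by apply: good; exact: geq_minr.
- have [ir|ri] := ltnP i r; last by rewrite (minn_idPr (leqW ri)).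
  by rewrite (minn_idPl ir); have [] := step i.+1 ir.
- have [ir|ri] := ltnP i r; last first.
    by rewrite sr; move=> b x _ _.
  by rewrite (minn_idPl ir); have [] := step i.+1 ir.
Qed.

Section Refine.
Context {G : topGroup} (a : aut G) (V : set G).
Hypothesis cG : compact [set: G].
Hypotheses (oV : onormal V) (eV : expansive a V).
Let bG : onormal_basis G := expansive_basis cG oV eV.

(* The term [i * q + j] of the refinement is [nub (s_i (s_{i+1} & t_j))]. *)
Definition refine (q : nat) (s t : nat -> set G) (n : nat) : set G :=
  nub a (zass (s (n %/ q)%N) (s (n %/ q).+1%N) (t (n %% q)%N)).

Lemma zass1 (P0 P1 : set G) : is_subgroup P0 -> is_subgroup P1 ->
  zass P0 P1 [set 1] = P0.
Proof.
move=> sP0 sP1; apply/seteqP; split=> x.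
  by move=> [y P0y [_ /= /(congr1 (tg_mul y))]]; grp => ->.
by move=> P0x; exists x => //; grp; split=> //; exact: sub1g.
Qed.

Lemma zassT (P0 P1 : set G) : P0 `<=` P1 -> is_subgroup P0 -> is_subgroup P1 ->
  zass P0 P1 setT = P1.
Proof.
move=> P01 sP0 sP1; apply/seteqP; split=> x.
  by move=> [y /P01 P1y [P1z _]]; exact: subMl (subV sP1 P1y) P1z.
by move=> P1x; exists 1; [exact: sub1g | grp].
Qed.

Section Chains.
Context (r q : nat) (s t : nat -> set G).
Hypotheses (hs : chain a r s) (ht : chain a q t) (q0 : (0 < q)%N).

Let cs i : csub a (s i) := csub_good (chain_good hs i).
Let ct i : csub a (t i) := csub_good (chain_good ht i).

(** The case [j = q] is included: the last term of block [i] and the first of block [i + 1] are both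
    the nub of [s i.+1]. *)
Lemma refineE i j : (j <= q)%N ->
  refine q s t (i * q + j)%N = nub a (zass (s i) (s i.+1) (t j)).
Proof.
rewrite leq_eqVlt => /orP[/eqP ->|jq]; last first.
  by rewrite /refine divnMDl // divn_small // addn0 modnMDl modn_small.
rewrite -mulSnr /refine mulnK // modnMl (chain0 ht) (chainT ht) //.
rewrite zass1 ?zassT //; try by [exact: csub_sub (cs _) | exact: chainS hs i].
Qed.

Lemma refine_mul i : refine q s t (i * q)%N = s i.
Proof.
rewrite -[(i * q)%N]addn0 refineE // (chain0 ht).
rewrite zass1; try exact: csub_sub (cs _).
exact (nub_good_id cG oV eV (chain_good hs i)).
Qed.

Lemma csub_refine i j : csub a (zass (s i) (s i.+1) (t j)).
Proof. by apply: csub_zass => //; exact: chain_normal hs i. Qed.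

Lemma refine_series : subnormal_series a (r * q) (refine q s t).
Proof.
split.
- by have := refine_mul 0; rewrite mul0n (chain0 hs).
- by rewrite refine_mul (chainT hs).
- by move=> n _; exact (good_nub cG oV eV (csub_refine _ _)).
- case=> // n _; rewrite succnK (divn_eq n q) -addnS.
  have jq : (n %% q < q)%N by rewrite ltn_mod.
  rewrite !refineE //; last exact: ltnW.
  set i := (n %/ q)%N; set j := (n %% q)%N.
  split.
  + by apply: nub_mono; apply: zass_mono; exact: chainS ht j.
  + move=> b x /(nub_subset (csub_closed (csub_refine i j.+1))).
    apply: nub_normal => //; apply: (@zass_normal _ a) => //.
    * exact: chain_normal hs i.
    * exact: chain_normal ht j.
  + apply: subquotient_transitive; first exact (nub_csub bG (csub_refine i j)).
    exact (good_nub cG oV eV (csub_refine i j.+1)).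
Qed.

End Chains.

Lemma refine_refinement r q (s t : nat -> set G) : (0 < q)%N ->
  subnormal_series a r s -> subnormal_series a q t ->
  refinement a r s (r * q)%N
    (refine q (fun i => s (minn i r)) (fun i => t (minn i q))).
Proof.
move=> q0 /series_chain hs /series_chain ht.
split; first exact (refine_series hs ht q0).
move=> i ir; exists (i * q)%N; first by rewrite leq_mul2r ir orbT.
by rewrite (refine_mul hs ht q0) (minn_idPl ir).
Qed.

Lemma swap_index_ltn r q (n : 'I_(r * q)) : (n %% q * r + n %/ q < r * q)%N.
Proof.
case: n => n /=; case: q => [|q]; first by rewrite muln0.
move=> nrq; have ir : (n %/ q.+1 < r)%N by rewrite ltn_divLR.
have jq : (n %% q.+1 < q.+1)%N by rewrite ltn_mod.
rewrite [(r * _)%N]mulnC; apply: (@leq_trans ((n %% q.+1).+1 * r)%N).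
  by rewrite mulSnr ltn_add2l.
by rewrite leq_mul2r jq orbT.
Qed.

(** For [n = i * q + j] this is [j * r + i], the place of the pair [(i, j)] in the other
    refinement. *)
Definition swap_index r q (n : 'I_(r * q)) : 'I_(r * q) :=
  Ordinal (swap_index_ltn n).

Lemma swap_index_inj r q : injective (@swap_index r q).
Proof.
move=> m n /(congr1 val) /= e; apply: val_inj => /=.
have lt (k : 'I_(r * q)) : (k %/ q < r)%N.
  case: k => k /=; case: (q) => [|q']; first by rewrite muln0.
  by rewrite ltn_divLR.
have r0 : (0 < r)%N := leq_ltn_trans (leq0n _) (lt m).
rewrite (divn_eq m q) (divn_eq n q).
have := congr1 (divn^~ r) e; have := congr1 (modn^~ r) e.
rewrite !modnMDl !divnMDl // !(modn_small (lt _)) !(divn_small (lt _)) !addn0.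
by move=> -> ->.
Qed.

Lemma refine_equivalent r q (s t : nat -> set G) :
  (0 < r)%N -> (0 < q)%N -> chain a r s -> chain a q t ->
  equivalent_series a (r * q)%N (refine q s t) (q * r)%N (refine r t s).
Proof.
move=> r0 q0 hs ht; exists (mulnC r q), (perm.perm (@swap_index_inj r q)) => n.
rewrite /series_sq /= perm.permE /=.
set i := (n %/ q)%N; set j := (n %% q)%N.
have jq : (j < q)%N by rewrite ltn_mod.
have ir : (i < r)%N by rewrite ltn_divLR // ltn_ord.
(* The upper term is at [i * q + (j + 1)], where [j + 1] may equal [q]; likewise [i + 1] may equal
   [r] on the other side. *)
rewrite {1 2}(divn_eq n q) -/i -/j -!addnS.
rewrite !(refineE hs ht q0) ?(ltnW jq) // !(refineE ht hs r0) ?(ltnW ir) //.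
have cs k := csub_good (chain_good hs k).
have ct k := csub_good (chain_good ht k).
apply: (zassenhaus cG oV eV (cs _) (cs _) (ct _) (ct _)).
- exact: chainS hs i.
- exact: chain_normal hs i.
- exact: chainS ht j.
- exact: chain_normal ht j.
Qed.

End Refine.

Lemma trivial_refinement (G : topGroup) (a : aut G) r (s : nat -> set G) :
  [set: G] = [set 1] -> subnormal_series a r s ->
  refinement a r s 0 (fun=> [set 1]).
Proof.
move=> G1 [s0 _ good _]; split.
  split=> //; first by move=> j _; rewrite -s0; exact: good.
  by case.
move=> i ir; exists 0%N => //; have [[s1 _ _] _ _ _] := good i ir.
apply/seteqP; split=> [_ ->//|x _].
by have : [set: G] x by []; rewrite G1.
Qed.

Theorem theorem6p19 (G : topGroup) (a : aut G) :
  compact [set: G] ->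
  top_transitive [set: G] a (ainv a) ->
  finite_depth a ->
  forall (r1 : nat) (s1 : nat -> set G) (r2 : nat) (s2 : nat -> set G),
    subnormal_series a r1 s1 ->
    subnormal_series a r2 s2 ->
    exists (r1' : nat) (s1' : nat -> set G) (r2' : nat) (s2' : nat -> set G),
      [/\ refinement a r1 s1 r1' s1',
          refinement a r2 s2 r2' s2' &
          equivalent_series a r1' s1' r2' s2'].
Proof.
move=> cG _ fd r1 s1 r2 s2 h1 h2.
have [V oV eV] := finite_depth_expansive cG fd.
(* The index arithmetic needs both lengths positive, and a series of length 0 forces [G] to be
   trivial. *)
have [G1|nG1] := pselect ([set: G] = [set 1]).
  exists 0%N, (fun=> [set 1]), 0%N, (fun=> [set 1]).
  split; try exact: trivial_refinement.
  by exists erefl, (perm.perm_one _); case.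
have length_gt0 r (s : nat -> set G) : subnormal_series a r s -> (0 < r)%N.
  by case: r => // -[s0 sr _ _]; case: nG1; rewrite -sr -s0.
have [r10 r20] := (length_gt0 _ _ h1, length_gt0 _ _ h2).
pose c1 i := s1 (minn i r1); pose c2 i := s2 (minn i r2).
exists (r1 * r2)%N, (refine a r2 c1 c2), (r2 * r1)%N, (refine a r1 c2 c1).
split.
- exact (refine_refinement cG oV eV r20 h1 h2).
- exact (refine_refinement cG oV eV r10 h2 h1).
- have [ch1 ch2] := (series_chain h1, series_chain h2).
  exact (refine_equivalent cG oV eV r10 r20 ch1 ch2).
Qed.
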